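(* Let $(\mu_1,\mu_2)=\mathcal{N}(\sigma_1,\sigma_2)$ be a Nikishin system, and for a multi-index $\boldsymbol{n}=(n_1,n_2)\in\mathbb{N}^2$ let $(A^{(1)}_{\boldsymbol{n}},A^{(2)}_{\boldsymbol{n}})$ be its type I multiple orthogonal polynomials. Write $\boldsymbol{e}_1=(1,0)$, $\boldsymbol{e}_2=(0,1)$. Then (i) $A^{(1)}_{\boldsymbol{n}}$, $A^{(1)}_{\boldsymbol{n}-\boldsymbol{e}_1}$ and $A^{(1)}_{\boldsymbol{n}-\boldsymbol{e}_2}$ are pairwise interlacing if $n_1+1\le n_2$. (ii) $A^{(2)}_{\boldsymbol{n}}$, $A^{(2)}_{\boldsymbol{n}-\boldsymbol{e}_1}$ and $A^{(2)}_{\boldsymbol{n}-\boldsymbol{e}_2}$ are pairwise interlacing if $n_1+1\ge n_2$.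
   Context: $\mathbb{N}=\{0,1,2,\dots\}$, $|\boldsymbol{n}|=n_1+n_2$. For $\Gamma\subseteq\mathbb{R}$, $\mathcal{M}(\Gamma)$ is the set of finite Borel measures of constant sign (positive or negative) with all moments finite and with infinite support contained in $\Gamma$. For a measure $\sigma$, $m_\sigma(z)=\int\frac{d\sigma(x)}{x-z}$. The pair $(\mu_1,\mu_2)\in\mathcal{M}(\mathbb{R})^2$ is a Nikishin system generated by $(\sigma_1,\sigma_2)$, written $(\mu_1,\mu_2)=\mathcal{N}(\sigma_1,\sigma_2)$, if there are closed intervals $\Gamma_1,\Gamma_2\subseteq\mathbb{R}$ with disjoint interiors and $\sigma_j\in\mathcal{M}(\Gamma_j)$ such that $\mu_1=\sigma_1$ and $d\mu_2(x)=m_{\sigma_2}(x)\,d\sigma_1(x)$. (If $\Gamma_1,\Gamma_2$ share an endpoint, it is part of the assumption that the latter defines a finite measure.) The type I multiple orthogonal polynomial at $\boldsymbol{n}$ is the non-zero vector of polynomials $(A^{(1)}_{\boldsymbol{n}},A^{(2)}_{\boldsymbol{n}})$ with $\deg A^{(j)}_{\boldsymbol{n}}\le n_j-1$, $j=1,2$, and $\sum_{j=1}^2\int A^{(j)}_{\boldsymbol{n}}(x)x^k\,d\mu_j(x)$ equal to $0$ for $k=0,\dots,|\boldsymbol{n}|-2$ and to $1$ for $k=|\boldsymbol{n}|-1$. Nikishin systems are known to be perfect, which means that these type I polynomials exist and are unique. Two real polynomials $p,q$ are interlacing if all zeros of $p$ and of $q$ are real and simple, $p$ and $q$ have no common zero,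 and between every two consecutive zeros of either one of the polynomials there lies exactly one zero of the other.
   Formalization: n1,n2 ≥ 1 is assumed so that n−e1, n−e2 are multi-indices; pairs with A^(1)_{n−e1} in (i) are claimed only for n1 ≥ 2, and pairs with A^(2)_{n−e2} in (ii) only for n2 ≥ 2, since otherwise that polynomial is zero and cannot interlace. *)

(* Defs.v *)
From mathcomp Require Import all_boot all_order all_algebra.
From mathcomp Require Import all_classical all_reals all_analysis.
From mathcomp Require Import complex.
Set Implicit Arguments.
Unset Strict Implicit.
Unset Printing Implicit Defensive.
Import Order.TTheory GRing.Theory Num.Theory.
Import numFieldNormedType.Exports.
Local Open Scope classical_set_scope.
Local Open Scope ring_scope.

(* A finite Borel measure of constant sign on the real line, represented as
   (-1) ^+ cs_neg times the positive finite measure cs_abs. *)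
Record cs_measure (R : realType) := CSMeasure {
  cs_neg : bool ;
  cs_abs : {finite_measure set (measurableTypeR R) -> \bar R} }.

Definition cs_sign (R : realType) (s : cs_measure R) : R := (-1) ^+ cs_neg s.

Definition cs_eval (R : realType) (s : cs_measure R) (B : set R) : \bar R :=
  ((cs_sign s)%:E * cs_abs s B)%E.

Definition cs_eintegral (R : realType) (s : cs_measure R) (D : set R)
    (f : R -> \bar R) : \bar R :=
  ((cs_sign s)%:E * \int[cs_abs s]_(x in D) f x)%E.

Definition cs_integral (R : realType) (s : cs_measure R) (f : R -> R) : R :=
  cs_sign s * \int[cs_abs s]_(x in setT) f x.

Definition cs_support (R : realType) (s : cs_measure R) : set R :=
  [set x | forall U : set R, open U -> U x -> cs_abs s U != 0%E].

Definition class_M (R : realType) (Gamma : set R) (s : cs_measure R) : Prop :=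
  [/\ forall k : nat, (cs_abs s).-integrable setT (fun x : R => (x ^+ k)%:E),
      infinite_set (cs_support s)
    & cs_support s `<=` Gamma].

(* m_s(x), the integral of ds(t) / (t - x), as an extended real.  The inverse is
   the one of \bar R, with 0^-1 = +oo rather than 0, so that m_s(x) is infinite
   whenever s has an atom at x. *)
Definition stieltjes (R : realType) (s : cs_measure R) (x : R) : \bar R :=
  cs_eintegral s setT (fun t => ((t - x)%:E^-1)%E).

Definition closed_interval (R : realType) (Gamma : set R) : Prop :=
  is_interval Gamma /\ closed Gamma.

(* (mu1, mu2) = N(sigma1, sigma2).  Since mu2 is finite, the last clause also
   contains the assumption that m_{sigma2} dsigma1 is a finite measure when
   Gamma1 and Gamma2 share an endpoint. *)
Definition nikishin_system (R : realType)
    (mu1 mu2 sigma1 sigma2 : cs_measure R) : Prop :=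
  [/\ class_M setT mu1, class_M setT mu2
    & exists Gamma1 Gamma2 : set R,
      [/\ closed_interval Gamma1 /\ closed_interval Gamma2,
          Gamma1° `&` Gamma2° = set0,
          class_M Gamma1 sigma1 /\ class_M Gamma2 sigma2,
          forall B : set R, measurable (B : set (measurableTypeR R)) ->
            cs_eval mu1 B = cs_eval sigma1 B
        & forall B : set R, measurable (B : set (measurableTypeR R)) ->
            cs_eval mu2 B = cs_eintegral sigma1 B (stieltjes sigma2)]].

(* A = (A^(1), A^(2)) is the type I multiple orthogonal polynomial at (n1, n2).
   A polynomial p has degree at most n - 1 iff size p <= n. *)
Definition type_I (R : realType) (mu1 mu2 : cs_measure R) (n1 n2 : nat)
    (A : {poly R} * {poly R}) : Prop :=
  let moment k := cs_integral mu1 (fun x => A.1.[x] * x ^+ k)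
                + cs_integral mu2 (fun x => A.2.[x] * x ^+ k) in
  [/\ A != (0, 0),
      (size A.1 <= n1)%N /\ (size A.2 <= n2)%N,
      forall k : nat, (k.+2 <= n1 + n2)%N -> moment k = 0
    & forall k : nat, (k.+1 = n1 + n2)%N -> moment k = 1].

(* All complex zeros are real and simple; this excludes the zero polynomial. *)
Definition real_simple_zeros (R : realType) (p : {poly R}) : Prop :=
  let pC := map_poly (real_complex R) p in
  forall z : complex R, root pC z -> complex.Im z = 0 /\ mup z pC = 1%N.

Definition consecutive_zeros (R : realType) (p : {poly R}) (x y : R) : Prop :=
  [/\ x < y, root p x, root p y & forall t, x < t < y -> ~~ root p t].

Definition one_zero_between (R : realType) (p q : {poly R}) : Prop :=
  forall x y, consecutive_zeros p x y -> exists! t, x < t < y /\ root q t.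

Definition interlacing (R : realType) (p q : {poly R}) : Prop :=
  [/\ real_simple_zeros p, real_simple_zeros q,
      forall x : R, ~ (root p x /\ root q x),
      one_zero_between p q
    & one_zero_between q p].

(* Main.v *)
Require Import Defs.
From mathcomp Require Import all_boot all_order all_algebra.
From mathcomp Require Import all_classical all_reals all_analysis.
From mathcomp Require Import complex measurable_realfun lra ring zify.

(* Let m be the Cauchy transform of sigma2 and let c separate the supports of
   sigma1 and sigma2.  If P1 + P2 m is orthogonal to 1, x, ..., x^(N-1) for
   sigma1, it has N distinct zeros x_i on the side of c carrying sigma1; only the
   values of P1, P2 and m at these zeros are used afterwards.  With
   w_i = 1 / prod_(j != i) (x_i - x_j) and Q = prod_i (X - x_i), partial
   fractions give sum_i p(x_i) m(x_i) w_i = int p / Q dsigma2 for size p <= N, so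
   this functional is definite on polynomials that are nonnegative on the line,
   while sum_i p(x_i) w_i = 0 for size p < N.  If P2 = ((X - a)^2 + b^2) H, then
   sum_i P2 H m w = - sum_i P1 H w = 0 contradicts definiteness; hence P2 has
   only real simple zeros.  For P1 one uses instead sum_i P1 H w / m = 0: on R^N
   the form sum_i f_i g_i m_i w_i is definite on the polynomials of size at most
   (N + 1) / 2, a subspace of maximal dimension for its sign, hence has the
   opposite sign on the orthogonal complement, which contains the vectors
   (h(x_i) / m(x_i))_i for size h <= N / 2.

   All of this applies to every nontrivial real combination of two of the three
   type I vectors, and two polynomials all of whose nontrivial combinations have
   only real simple zeros interlace: their Wronskian does not vanish. *)

Section Nikishin.
Local Open Scope classical_set_scope.
Local Open Scope ring_scope.
Import Order.TTheory GRing.Theory Num.Theory numFieldNormedType.Exports.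
Set Implicit Arguments.
Unset Strict Implicit.
Unset Printing Implicit Defensive.

(** * Lagrange interpolation and divided differences *)

Section Lagrange.
Variables (R : realFieldType) (n : nat) (x : 'I_n -> R).
Hypothesis x_inj : injective x.

(** The leading coefficient of the [i]-th Lagrange basis polynomial, so that the sum of [p.[x i] *
    node_weight i] is the divided difference of [p] at the nodes. *)
Definition node_weight (i : 'I_n) : R := (\prod_(j | j != i) (x i - x j))^-1.

Let base (i : 'I_n) : {poly R} := \prod_(j | j != i) ('X - (x j)%:P).

Let node_prod_neq0 i : \prod_(j | j != i) (x i - x j) != 0.
Proof.
apply/prodf_neq0 => j ji; rewrite subr_eq0; apply/eqP => /x_inj ij.
by rewrite ij eqxx in ji.
Qed.

Lemma node_weight_neq0 i : node_weight i != 0.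
Proof. by rewrite invr_eq0 node_prod_neq0. Qed.

Let base_monic i : base i \is monic.
Proof. by apply: monic_prod => j _; exact: monicXsubC. Qed.

Let size_base i : size (base i) = n.
Proof.
rewrite /base size_prod; last by move=> j _; rewrite polyXsubC_eq0.
rewrite (eq_bigr (fun=> 2%N)); last by move=> j _; rewrite size_XsubC.
rewrite sum_nat_const.
have -> : #|[pred j | j != i]| = n.-1 by rewrite cardC1 card_ord.
by have := leq_ltn_trans (leq0n i) (ltn_ord i); lia.
Qed.

Let horner_base i j : (base j).[x i] = (j == i)%:R * (node_weight i)^-1.
Proof.
rewrite horner_prod; case: eqP => [->|/eqP ji].
  rewrite mul1r invrK; apply: eq_bigr => k _; exact: hornerXsubC.
by rewrite (bigD1 i) 1?eq_sym//= hornerXsubC subrr !mul0r.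
Qed.

Let lagr (v : 'I_n -> R) := \sum_i (v i * node_weight i) *: base i.

Let size_lagr v : (size (lagr v) <= n)%N.
Proof.
rewrite (leq_trans (size_sum _ _ _))//.
apply/bigmax_leqP => i _; rewrite (leq_trans (size_scale_leq _ _))//.
by rewrite size_base.
Qed.

Let horner_lagr v i : (lagr v).[x i] = v i.
Proof.
rewrite horner_sum (bigD1 i)//= big1 ?addr0.
  by rewrite hornerZ horner_base eqxx mul1r mulfK ?node_weight_neq0.
by move=> j /negPf ji; rewrite hornerZ horner_base ji mul0r mulr0.
Qed.

Lemma interpolation (v : 'I_n -> R) :
  exists2 f : {poly R}, (size f <= n)%N & forall i, f.[x i] = v i.
Proof. by exists (lagr v). Qed.

Lemma lagrange_interpolation (p : {poly R}) : (size p <= n)%N ->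
  p = \sum_i (p.[x i] * node_weight i) *: \prod_(j | j != i) ('X - (x j)%:P).
Proof.
move=> sp; apply/eqP; rewrite -subr_eq0; apply/eqP.
apply: (@roots_geq_poly_eq0 _ _ [seq x i | i <- enum 'I_n]).
- apply/allP => _ /mapP[i _ ->].
  by rewrite /root hornerD hornerN horner_lagr subrr.
- by rewrite map_inj_uniq ?enum_uniq.
- rewrite size_map size_enum_ord (leq_trans (size_polyD _ _))// geq_max sp /=.
  by rewrite size_polyN size_lagr.
Qed.

(** Compare the coefficients of X^(n-1) on both sides of Lagrange's formula. *)
Lemma node_weight_sum0 (p : {poly R}) : (size p < n)%N ->
  \sum_i p.[x i] * node_weight i = 0.
Proof.
move=> sp.
have := congr1 (fun q : {poly R} => q`_n.-1) (lagrange_interpolation (ltnW sp)).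
rewrite nth_default; last by case: (n) sp.
rewrite coef_sum => e; rewrite [RHS]e; apply: eq_bigr => i _.
have /monicP := base_monic i; rewrite lead_coefE size_base => bi.
by rewrite coefZ bi mulr1.
Qed.

Lemma node_weight_partial_fractions (p : {poly R}) (t : R) :
    (size p <= n)%N -> (forall i, t != x i) ->
  p.[t] / \prod_i (t - x i) = \sum_i p.[x i] * node_weight i / (t - x i).
Proof.
move=> sp tx; rewrite {1}(lagrange_interpolation sp) horner_sum mulr_suml.
apply: eq_bigr => i _; rewrite hornerZ horner_prod.
under eq_bigr do rewrite hornerXsubC.
rewrite [in X in _ / X](bigD1 i)//= invfM -!mulrA; congr (_ * (_ * _)).
rewrite mulrCA mulfV ?mulr1//; apply/prodf_neq0 => j _.
by rewrite subr_eq0 tx.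
Qed.

End Lagrange.

(** * A definite functional on nodes and the signature of its quadratic form *)

Section Nodes.
Variable R : realFieldType.

(** All that the algebraic part keeps of sigma2: [M i] stands for m_{sigma2} at the node [x i], and
    [s] absorbs the global sign. By the last clause the signs of [M i * node_weight x i] alternate
    with [i], starting with the sign of [s]. *)
Definition stieltjes_nodes (n : nat) (x M : 'I_n -> R) (s : R) : Prop :=
  [/\ injective x,
      forall p : {poly R}, p != 0 -> (size p <= n)%N ->
        (forall t, 0 <= p.[t]) ->
        0 < s * \sum_i p.[x i] * M i * node_weight x i
    & forall i : 'I_n, 0 < s * (-1) ^+ i * M i * node_weight x i].

Variables (n : nat) (x M : 'I_n -> R) (s : R).
Hypothesis H : stieltjes_nodes x M s.

Lemma stieltjes_nodes_neq0 i : M i != 0.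
Proof.
case: H => _ _ /(_ i); apply: contraTneq => ->.
by rewrite mulr0 mul0r ltxx.
Qed.

(* The form [f, g] = sum f g M w has signature (uphalf n, n./2) and is positive
   on polynomials of size at most uphalf n, hence negative on their orthogonal
   complement, which contains h / M. *)
Lemma stieltjes_nodes_inverse (h : {poly R}) : h != 0 -> (size h <= n./2)%N ->
  s * (\sum_i h.[x i] ^+ 2 / M i * node_weight x i) < 0.
Proof.
case: (H) => xi pos alt h0 sh.
(* The nodes of even index, at which the form is positive. *)
have lt2 (k : 'I_(uphalf n)) : (k.*2 < n)%N by have := ltn_ord k; lia.
pose y (k : 'I_(uphalf n)) := Ordinal (lt2 k).
have y_inj : injective (x \o y).
  by move=> k l /xi [] e; apply/val_inj/double_inj.
pose v i := h.[x i] / M i.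
(* [f] agrees with [v = h / M] at the even nodes, so [v - f] lives on the odd nodes, where the form
   is negative. *)
have [f sf fv] := interpolation y_inj (v \o y).
have hv i : h.[x i] = v i * M i by rewrite /v divfK ?stieltjes_nodes_neq0.
have -> : \sum_i h.[x i] ^+ 2 / M i * node_weight x i =
          \sum_i v i ^+ 2 * M i * node_weight x i.
  apply: eq_bigr => i _; rewrite hv; have := stieltjes_nodes_neq0 i => Mi.
  by congr (_ * _); field.
(* The factor [M] cancels, leaving the divided difference of [h * f], whose size is less than
   [n]. *)
have orth : \sum_i v i * f.[x i] * M i * node_weight x i = 0.
  rewrite -[RHS](@node_weight_sum0 _ _ x xi (h * f)).
    by apply: eq_bigr => i _; rewrite hornerM hv; ring.
  by have := size_polyMleq h f; rewrite -size_poly_gt0 in h0; lia.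
(* Pythagoras: [v, v] = [v - f, v - f] - [f, f], because [v, f] = 0. *)
have split : \sum_i v i ^+ 2 * M i * node_weight x i =
   \sum_i (v i - f.[x i]) ^+ 2 * M i * node_weight x i -
   \sum_i (f * f).[x i] * M i * node_weight x i.
  suff -> : \sum_i (v i - f.[x i]) ^+ 2 * M i * node_weight x i =
      \sum_i v i ^+ 2 * M i * node_weight x i -
      2 * (\sum_i v i * f.[x i] * M i * node_weight x i) +
      \sum_i (f * f).[x i] * M i * node_weight x i.
    by rewrite orth mulr0 subr0 addrK.
  rewrite mulr_sumr -sumrB -big_split/=.
  by apply: eq_bigr => i _; rewrite hornerM; ring.
have neg i : s * ((v i - f.[x i]) ^+ 2 * M i * node_weight x i) <= 0.
  have [odd_i|even_i] := boolP (odd i).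
    have := alt i; rewrite -signr_odd odd_i expr1 => a.
    have -> : s * ((v i - f.[x i]) ^+ 2 * M i * node_weight x i) =
      - ((v i - f.[x i]) ^+ 2 * (s * -1 * M i * node_weight x i)) by ring.
    by rewrite oppr_le0 mulr_ge0 ?sqr_ge0// ltW.
  have ui : (i./2 < uphalf n)%N by have := ltn_ord i; lia.
  have -> : i = y (Ordinal ui) by apply: val_inj => /=; lia.
  by rewrite fv subrr expr0n/= !mul0r mulr0.
have negs : s * \sum_i (v i - f.[x i]) ^+ 2 * M i * node_weight x i <= 0.
  by rewrite mulr_sumr; apply: sumr_le0 => i _.
have [f0|f0] := eqVneq f 0; last first.
  have ff : 0 < s * \sum_i (f * f).[x i] * M i * node_weight x i.
    apply: pos; first by rewrite mulf_neq0.
      by have := size_polyMleq f f; rewrite -size_poly_gt0 in f0; lia.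
    by move=> t; rewrite hornerM -expr2 sqr_ge0.
  by rewrite split mulrBr; lra.
(* If [f = 0], strictness comes from [h] itself: equality would make [h] vanish at all [n] nodes,
   too many for its size. *)
rewrite split mulrBr f0 mul0r [X in _ - s * X]big1 ?mulr0 ?subr0; last first.
  by move=> i _; rewrite horner0 !mul0r.
rewrite f0 in negs; rewrite lt_neqAle negs andbT; apply: contraNN h0 => /eqP e.
apply/eqP; apply: (@roots_geq_poly_eq0 _ _ [seq x i | i <- enum 'I_n]).
- apply/allP => _ /mapP[i _ ->].
  have /eqP : - (s * \sum_i (v i - (0 : {poly R}).[x i]) ^+ 2 * M i
      * node_weight x i) = 0 by rewrite e oppr0.
  rewrite mulr_sumr -sumrN psumr_eq0 => [|j _]; last by rewrite oppr_ge0 -f0.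
  move=> /allP/(_ i (mem_index_enum _))/=.
  have wi := node_weight_neq0 xi i; have Mi := stieltjes_nodes_neq0 i.
  have s0 : s != 0 by apply: contraTneq (alt i) => ->; rewrite !mul0r ltxx.
  rewrite horner0 subr0 oppr_eq0 !mulf_eq0 (negPf wi) (negPf Mi) (negPf s0).
  by rewrite invr_eq0 (negPf Mi) /= !orbF orbb.
- by rewrite map_inj_uniq ?enum_uniq.
- rewrite size_map size_enum_ord (leq_trans sh)//; lia.
Qed.

End Nodes.

(** * Interlacing from pencils of polynomials with only real simple zeros *)

Section Pencil.
Variable R : realType.
Implicit Types p q : {poly R}.

(** The real polynomial with zeros a + ib and a - ib. As [b = 0] gives a double real zero,
    divisibility by it covers both non-real and multiple zeros. *)
Definition square_sum (a b : R) : {poly R} := ('X - a%:P) ^+ 2 + (b ^+ 2)%:P.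

Lemma square_sum_ge0 (a b t : R) : 0 <= (square_sum a b).[t].
Proof. by rewrite /square_sum !hornerE addr_ge0 ?sqr_ge0. Qed.

Lemma size_square_sum (a b : R) : size (square_sum a b) = 3%N.
Proof.
rewrite /square_sum size_polyDl size_exp_XsubC//.
by rewrite (leq_ltn_trans (size_polyC_leq1 _)).
Qed.

Lemma square_sum_neq0 (a b : R) : square_sum a b != 0.
Proof. by rewrite -size_poly_eq0 size_square_sum. Qed.

Lemma double_root_dvdp p (a : R) : p.[a] = 0 -> p^`().[a] = 0 ->
  square_sum a 0 %| p.
Proof.
move=> pa dpa; rewrite /square_sum expr0n /= addr0.
have /factor_theorem[q pq] : root p a by apply/eqP.
have : root q a.
  by move: dpa; rewrite pq derivM derivXsubC !hornerE subrr mulr0 add0r => /eqP.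
by move=> /factor_theorem[r qr]; rewrite pq qr -mulrA -expr2 dvdp_mull.
Qed.

(** At a zero a + ib with b non-zero, the remainder modulo [square_sum a b] has degree at most 1 and
    vanishes there, so it is zero. At a real zero, multiplicity two or more means divisibility with
    [b = 0]. *)
Lemma real_simple_zeros_square_sum p :
  (forall a b, ~~ (square_sum a b %| p)) -> real_simple_zeros p.
Proof.
move=> pN; have p0 : p != 0 by apply: contraNneq (pN 0 0) => ->; rewrite dvdp0.
rewrite /real_simple_zeros => -[a b] /= rpz.
have b0 : b = 0.
  apply/eqP; apply: contraNT (pN a b) => b0.
  have sr : (size (p %% square_sum a b)%R <= 2)%N.
    by rewrite -ltnS -(size_square_sum a b) ltn_modp square_sum_neq0.
  have /(congr1 (fun q => (map_poly (real_complex R) q).[(a +i* b)%C])) :=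
    divp_eq p (square_sum a b).
  rewrite (rootP rpz) rmorphD rmorphM /= hornerD hornerM.
  have -> : (map_poly (real_complex R) (square_sum a b)).[(a +i* b)%C] = 0.
    rewrite /square_sum rmorphD rmorphXn/= rmorphB/= map_polyX !map_polyC/=.
    rewrite !hornerE.
    apply/eqP; rewrite eq_complex /= expr2 /=; apply/andP; split; apply/eqP; ring.
  rewrite mulr0 add0r /dvdp.
  move: (p %% square_sum a b) sr => r sr.
  rewrite (horner_coef_wide _ (n := 2)) ?size_map_poly//.
  rewrite !big_ord_recl big_ord0 /= !coef_map /= expr0 mulr1 expr1 addr0.
  move=> /eqP; rewrite eq_complex /= => /andP[/eqP h1 /eqP h2].
  have r1 : r`_1 = 0.
    by apply: (mulIf b0); rewrite mul0r; move: h2; rewrite /bump/=; lra.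
  apply/eqP/polyP => -[|[|i]]; rewrite coef0 ?r1//.
    by move: h1; rewrite /bump/= r1; lra.
  by rewrite nth_default// (leq_trans sr).
split => //; move: rpz; rewrite b0 => rpz.
set z := (a +i* 0)%C in rpz *.
have pC0 : map_poly (real_complex R) p != 0 by rewrite map_poly_eq0.
apply/eqP; rewrite eqn_leq mup_leq// -XsubC_dvd// dvdp_XsubCl rpz andbT.
apply: contra (pN a 0); rewrite /square_sum expr0n/= addr0.
rewrite -(dvdp_map (real_complex R)) rmorphXn/= rmorphB/= map_polyX map_polyC.
by [].
Qed.

Section Interlacing.
Variables p q : {poly R}.
Hypothesis pqN : forall a b : R, (a, b) != (0, 0) ->
  forall u v, ~~ (square_sum u v %| a *: p + b *: q).

(** At a common zero x, either p has a double zero or the combination q'(x) p - p'(x) q does. *)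
Lemma pencil_no_common_root x : ~ (root p x /\ root q x).
Proof.
move=> [/rootP px /rootP qx].
have [dp|dp] := eqVneq p^`().[x] 0.
  have : (1, 0) != (0, 0) :> R * R by rewrite xpair_eqE oner_eq0.
  move=> /pqN/(_ x 0)/negP; apply.
  by rewrite scale1r scale0r addr0 double_root_dvdp.
have : (q^`().[x], - p^`().[x]) != (0, 0) by rewrite xpair_eqE oppr_eq0 (negPf dp) andbF.
move=> /pqN/(_ x 0)/negP; apply; apply: double_root_dvdp.
  by rewrite !hornerE px qx !mulr0 addr0.
by rewrite derivD !derivZ !hornerE mulNr mulrC subrr.
Qed.

(* Otherwise Rolle's theorem for p / q gives a point c at which the derivatives
   of p and q are proportional to the values, so that q(c) p - p(c) q has a
   double zero at c. *)
Lemma pencil_root_between x y : x < y -> root p x -> root p y ->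
  exists2 t, x <= t <= y & root q t.
Proof.
move=> xy px py; apply: contrapT => nq.
have q0 t : x <= t <= y -> q.[t] != 0 by move=> xty; apply/negP => qt; apply: nq; exists t.
pose qV t := (q.[t])^-1; pose f : R -> R := horner p * qV.
have dqV t : x <= t <= y -> is_derive t 1 qV (- q.[t] ^- 2 *: q^`().[t]).
  move=> /q0 qt; apply: DeriveDef.
    exact: (@derivableV _ _ (horner q) _ _ qt (@derivable_horner _ q t)).
  rewrite (@deriveV _ _ (horner q) _ _ qt (@derivable_horner _ q t)).
  by rewrite (@derive_val _ _ _ _ _ _ _ (is_derive_poly q t)).
have df t : x <= t <= y -> is_derive t 1 f
    (p.[t] *: (- q.[t] ^- 2 *: q^`().[t]) + qV t *: p^`().[t]).
  by move=> /dqV; apply: is_deriveM; exact: is_derive_poly.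
have [|||c /andP[xc cy] fc] := @Rolle R f x y xy.
- move=> t; rewrite in_itv/= => /andP[/ltW xt /ltW ty].
  by have := df t; rewrite xt ty => /(_ isT)[].
- apply: continuous_in_subspaceT => t; rewrite inE/= in_itv/= => /df[ft _].
  by apply: differentiable_continuous; apply/derivable1_diffP.
- by rewrite /f /= !fctE (rootP px) (rootP py) !mul0r.
have xcy : x <= c <= y by move: xc cy; rewrite !bnd_simp => /ltW -> /ltW ->.
have qc := q0 _ xcy.
have := df _ xcy => -[_]; case: fc => _ -> /esym/eqP.
rewrite /GRing.scale/= /qV => /eqP W.
have {}W : p^`().[c] * q.[c] - p.[c] * q^`().[c] = 0.
  by rewrite -[RHS](mulr0 (q.[c] ^+ 2)) -W; field.
have : (q.[c], - p.[c]) != (0, 0) by rewrite xpair_eqE (negPf qc).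
move=> /pqN/(_ c 0)/negP; apply; apply: double_root_dvdp.
  by rewrite !hornerE mulNr mulrC subrr.
by rewrite derivD !derivZ !hornerE -[RHS]W; ring.
Qed.

End Interlacing.

Lemma pencil_one_zero_between p q :
  (forall a b : R, (a, b) != (0, 0) ->
    forall u v, ~~ (square_sum u v %| a *: p + b *: q)) ->
  one_zero_between p q.
Proof.
move=> pqN x y [xy px py pN].
have qpN (a b : R) : (a, b) != (0, 0) ->
    forall u v, ~~ (square_sum u v %| a *: q + b *: p).
  by move=> ab; rewrite addrC; apply: pqN; move: ab; rewrite !xpair_eqE andbC.
have [t /andP[xt ty] qt] := pencil_root_between pqN xy px py.
have xt' : x < t.
  rewrite lt_neqAle xt andbT; apply/eqP => e.
  by apply: (pencil_no_common_root pqN (x := x)); rewrite {2}e.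
have ty' : t < y.
  rewrite lt_neqAle ty andbT; apply/eqP => e.
  by apply: (pencil_no_common_root pqN (x := y)); rewrite -{2}e.
exists t; split; first by rewrite xt' ty'.
(* Two zeros of [q] inside would, with the roles of [p] and [q] exchanged, enclose a zero of [p]
   between consecutive ones. *)
have uniq u v : x < u -> u < v -> v < y -> root q u -> root q v -> False.
  move=> xu uv vy qu qv.
  have [w /andP[uw wv]] := pencil_root_between qpN uv qu qv.
  by apply/negP/pN; rewrite (lt_le_trans xu)//= (le_lt_trans wv).
move=> u [/andP[xu uy] qu].
have [tu|ut|//] := ltgtP t u; exfalso; first exact: (uniq t u).
exact: (uniq u t).
Qed.

Lemma pencil_interlacing p q :
  (forall a b : R, (a, b) != (0, 0) ->
    forall u v, ~~ (square_sum u v %| a *: p + b *: q)) ->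
  interlacing p q.
Proof.
move=> pqN.
have qpN (a b : R) : (a, b) != (0, 0) ->
    forall u v, ~~ (square_sum u v %| a *: q + b *: p).
  by move=> ab; rewrite addrC; apply: pqN; move: ab; rewrite !xpair_eqE andbC.
have n10 : (1, 0) != (0, 0) :> R * R by rewrite xpair_eqE oner_eq0.
split.
- apply: real_simple_zeros_square_sum => a b.
  by have := pqN _ _ n10 a b; rewrite scale1r scale0r addr0.
- apply: real_simple_zeros_square_sum => a b.
  by have := qpN _ _ n10 a b; rewrite scale1r scale0r addr0.
- exact: pencil_no_common_root.
- exact: pencil_one_zero_between.
- exact: pencil_one_zero_between.
Qed.

End Pencil.

(** * Consequences of the node relations for the two components *)

Section TypeI.
Variable R : realType.
Implicit Types (P Q : {poly R} * {poly R}) (H : {poly R}).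

(* Restated over R itself, so that lia identifies the sizes. *)
Let sz_gt0 (p : {poly R}) : p != 0 -> (0 < size p)%N.
Proof. by rewrite size_poly_gt0. Qed.

Let szM (p q : {poly R}) : (size (p * q)%R <= (size p + size q).-1)%N.
Proof. exact: size_polyMleq. Qed.

Let szMsq (p : {poly R}) a b : p != 0 ->
  size (p * square_sum a b)%R = (size p).+2.
Proof.
by move=> p0; rewrite size_mul ?square_sum_neq0// size_square_sum addn3.
Qed.

Let szMXa (p : {poly R}) a : p != 0 ->
  size (('X - a%:P) * p)%R = (size p).+1.
Proof. by move=> p0; rewrite size_monicM ?monicXsubC// size_XsubC. Qed.

Let szZ (a : R) (p : {poly R}) : (size (a *: p)%R <= size p)%N.
Proof. exact: size_scale_leq. Qed.

(** Serves the cases [n1 = 1] and [n2 = 1], where the components are non-zero constants and have no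
    zeros at all. *)
Lemma interlacing_const (p q : {poly R}) : p != 0 -> q != 0 ->
  (size p <= 1)%N -> (size q <= 1)%N -> interlacing p q.
Proof.
have rootN (r : {poly R}) x : r != 0 -> (size r <= 1)%N -> root r x = false.
  by move=> r0 /size1_polyC e; rewrite e rootC -polyC_eq0 -e (negPf r0).
have simple (r : {poly R}) : r != 0 -> (size r <= 1)%N -> real_simple_zeros r.
  move=> r0 s1; apply: real_simple_zeros_square_sum => a b.
  by apply/negP => /(dvdp_leq r0); rewrite size_square_sum leqNgt (leq_ltn_trans s1).
move=> p0 q0 sp sq; split; [exact: simple|exact: simple|..].
- by move=> x []; rewrite rootN.
- by move=> x y []; rewrite rootN.
- by move=> x y []; rewrite rootN.
Qed.

Section AtNodes.
Variables (N : nat) (x M : 'I_N -> R) (s : R) (P : {poly R} * {poly R}).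
Hypothesis HN : stieltjes_nodes x M s.
Hypothesis HP : forall i, P.1.[x i] + P.2.[x i] * M i = 0.

Let x_inj : injective x. Proof. by case: HN. Qed.

Let vanish (p : {poly R}) : (size p <= N)%N -> (forall i, p.[x i] = 0) -> p = 0.
Proof.
move=> sp px; apply: (@roots_geq_poly_eq0 _ _ [seq x i | i <- enum 'I_N]).
- by apply/allP => _ /mapP[i _ ->]; apply/rootP.
- by rewrite map_inj_uniq ?enum_uniq.
- by rewrite size_map size_enum_ord.
Qed.

Lemma nodes_eq0_l : P.1 = 0 -> (size P.2 <= N)%N -> P.2 = 0.
Proof.
move=> P1 sP2; apply: vanish => // i.
have /eqP := HP i; rewrite P1 horner0 add0r mulf_eq0.
by rewrite (negPf (stieltjes_nodes_neq0 HN i)) orbF => /eqP.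
Qed.

Lemma nodes_eq0_r : P.2 = 0 -> (size P.1 <= N)%N -> P.1 = 0.
Proof.
by move=> P2 sP1; apply: vanish => // i; have := HP i; rewrite P2 horner0 mul0r addr0.
Qed.

Let size_mul_lt (p q : {poly R}) : p * q != 0 -> (size p + size q <= N)%N ->
  (size (p * q)%R < N)%N.
Proof.
rewrite mulf_eq0 negb_or => /andP[/sz_gt0 p0 /sz_gt0 q0].
by have := szM p q; lia.
Qed.

(** Multiply the node relations by [H] and the weights and sum: the [P.1 * H] part is a vanishing
    divided difference, so the definite functional is zero on [P.2 * H]. *)
Lemma nodes_mul_ge0_r H : (size P.1 + size H <= N)%N ->
  (size (P.2 * H)%R <= N)%N -> (forall t, 0 <= (P.2 * H).[t]) -> P.2 * H = 0.
Proof.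
move=> s1 s2 ge0; apply/eqP; apply: contraT => PH0.
case: (HN) => _ /(_ _ PH0 s2 ge0) + _.
have -> : \sum_i (P.2 * H).[x i] * M i * node_weight x i =
  - \sum_i (P.1 * H).[x i] * node_weight x i.
  rewrite -sumrN; apply: eq_bigr => i _; rewrite !hornerM.
  have := HP i; move: (P.2.[x i]) => p2; rewrite -(addrC (p2 * M i)).
  by move/eqP; rewrite addr_eq0 => /eqP e; rewrite -mulNr -mulNr -e; ring.
have [->|PH1] := eqVneq (P.1 * H) 0.
  by rewrite big1 ?oppr0 ?mulr0 ?ltxx// => i _; rewrite horner0 mul0r.
by rewrite node_weight_sum0 ?oppr0 ?mulr0 ?ltxx// size_mul_lt.
Qed.

(** Here the node relations are divided by [M] before summing: now the [P.2 * H] part vanishes,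
    while by [stieltjes_nodes_inverse] every non-zero square contributes strictly negatively. *)
Lemma nodes_mul_squares_l H h1 h2 : (size P.2 + size H <= N)%N ->
  P.1 * H = h1 ^+ 2 + h2 ^+ 2 -> (size h1 <= N./2)%N -> (size h2 <= N./2)%N ->
  h1 = 0.
Proof.
move=> s2 PH sh1 sh2; apply/eqP; apply: contraT => h10.
have neg := stieltjes_nodes_inverse HN h10 sh1.
have nneg : s * (\sum_i h2.[x i] ^+ 2 / M i * node_weight x i) <= 0.
  have [->|h20] := eqVneq h2 0; last exact/ltW/(stieltjes_nodes_inverse HN).
  by rewrite big1 ?mulr0// => i _; rewrite horner0 expr0n/= !mul0r.
have : s * (\sum_i h1.[x i] ^+ 2 / M i * node_weight x i) +
       s * (\sum_i h2.[x i] ^+ 2 / M i * node_weight x i) =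
       - (s * \sum_i (P.2 * H).[x i] * node_weight x i).
  rewrite -mulrDr -mulrN -big_split -sumrN /=; congr (_ * _).
  apply: eq_bigr => i _; rewrite -mulrDl -mulrDl -!horner_exp -hornerD -PH !hornerM.
  have Mi := stieltjes_nodes_neq0 HN i; have := HP i => /eqP.
  by rewrite addr_eq0 => /eqP ->; field.
have -> : \sum_i (P.2 * H).[x i] * node_weight x i = 0.
  have [->|PH2] := eqVneq (P.2 * H) 0.
    by rewrite big1// => i _; rewrite horner0 mul0r.
  by rewrite node_weight_sum0// size_mul_lt.
by rewrite mulr0 oppr0; lra.
Qed.

End AtNodes.

Definition interpolated_at_nodes (N : nat) P : Prop :=
  exists (x M : 'I_N -> R) (s : R),
    stieltjes_nodes x M s /\ forall i, P.1.[x i] + P.2.[x i] * M i = 0.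

Section Interpolated.
Variables (n1 n2 : nat) (P : {poly R} * {poly R}).
Hypothesis HI : interpolated_at_nodes (n1 + n2 - 2) P.

(** Test against the cofactor: [P.2 * H] is [square_sum a b] times a square, hence nonnegative. Its
    size is at most 2 n2 - 3, which is within n1 + n2 - 2 exactly when n2 <= n1 + 1. *)
Lemma interpolated_square_sum_r (a b : R) :
  (size P.1 <= n1)%N -> (size P.2 <= n2)%N -> (n2 <= n1 + 1)%N ->
  P.2 != 0 -> ~~ (square_sum a b %| P.2).
Proof.
case: HI => x [M [s [HN HP]]] s1 s2 n21 P20; apply/negP => D.
have [H PH] : exists H : {poly R}, P.2 = H * square_sum a b by exact/dvdpP.
have H0 : H != 0 by apply: contraNneq P20 => H0; rewrite PH H0 mul0r.
have sP : size P.2 = (size H).+2.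
  by rewrite PH szMsq.
suff /eqP : P.2 * H = 0 by rewrite mulf_eq0 (negPf P20) (negPf H0).
apply: (nodes_mul_ge0_r HN HP); first by lia.
- by have := szM P.2 H; lia.
- move=> t; rewrite PH mulrAC -expr2 hornerM horner_exp.
  by rewrite mulr_ge0 ?sqr_ge0 ?square_sum_ge0.
Qed.

(** With the cofactor [H], [P.1 * H] is the sum of the squares of (X - a) H and b H. Their sizes are
    at most n1 - 1, and n1 + 1 <= n2 puts this below half of n1 + n2 - 2. *)
Lemma interpolated_square_sum_l (a b : R) :
  (size P.1 <= n1)%N -> (size P.2 <= n2)%N -> (n1 + 1 <= n2)%N ->
  P.1 != 0 -> ~~ (square_sum a b %| P.1).
Proof.
case: HI => x [M [s [HN HP]]] s1 s2 n21 P10; apply/negP => D.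
have [H PH] : exists H : {poly R}, P.1 = H * square_sum a b by exact/dvdpP.
have H0 : H != 0 by apply: contraNneq P10 => H0; rewrite PH H0 mul0r.
have sP : size P.1 = (size H).+2.
  by rewrite PH szMsq.
have XH0 : ('X - a%:P) * H != 0 by rewrite mulf_neq0 ?polyXsubC_eq0.
suff /eqP : ('X - a%:P) * H = 0 by rewrite (negPf XH0).
apply: (nodes_mul_squares_l HN HP (H := H) (h2 := b *: H)); first by lia.
- by rewrite PH /square_sum -mul_polyC polyC_exp; ring.
- by rewrite szMXa//; lia.
- by rewrite (leq_trans (szZ _ _))//; lia.
Qed.

(** Test [P.2] against itself. Together with its companion for [P.1], this separates the type I
    vectors at n - e_1 and n - e_2: if equal, they would satisfy both size bounds. *)
Lemma interpolated_small_r : (size P.1 <= n1.-1)%N -> (size P.2 <= n2.-1)%N ->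
  (0 < n2)%N -> (n2 <= n1 + 1)%N -> P.2 = 0.
Proof.
case: HI => x [M [s [HN HP]]] s1 s2 n20 n21; apply/eqP; apply: contraT => P20.
suff /eqP : P.2 * P.2 = 0 by rewrite mulf_eq0 (negPf P20).
apply: (nodes_mul_ge0_r HN HP); first by lia.
- by have := szM P.2 P.2; have := sz_gt0 P20; lia.
- by move=> t; rewrite hornerM -expr2 sqr_ge0.
Qed.

Lemma interpolated_small_l : (size P.1 <= n1.-1)%N -> (size P.2 <= n2.-1)%N ->
  (0 < n1)%N -> (n1 + 1 <= n2)%N -> P.1 = 0.
Proof.
case: HI => x [M [s [HN HP]]] s1 s2 n20 n21.
apply: (nodes_mul_squares_l HN HP (H := P.1) (h2 := 0)); first by lia.
- by rewrite expr0n/= addr0 expr2.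
- lia.
- by rewrite size_poly0.
Qed.

End Interpolated.

Lemma interpolated_eq0_l N P : interpolated_at_nodes N P ->
  P.1 = 0 -> (size P.2 <= N)%N -> P.2 = 0.
Proof. by case=> x [M [s [HN HP]]]; exact: nodes_eq0_l HN HP. Qed.

Lemma interpolated_eq0_r N P : interpolated_at_nodes N P ->
  P.2 = 0 -> (size P.1 <= N)%N -> P.1 = 0.
Proof. by case=> x [M [s [HN HP]]]; exact: nodes_eq0_r HN HP. Qed.

End TypeI.

(** * Independence and interlacing of the three type I vectors *)

Section MomentFunctional.
Variable R : realType.
Variable mom : {poly R} * {poly R} -> nat -> R.

Let comb (a b : R) (P Q : {poly R} * {poly R}) : {poly R} * {poly R} :=
  (a *: P.1 + b *: Q.1, a *: P.2 + b *: Q.2).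

Hypothesis mom_comb : forall a b P Q k,
  mom (comb a b P Q) k = a * mom P k + b * mom Q k.
Hypothesis mom_nodes : forall N P,
  (forall k, (k < N)%N -> mom P k = 0) -> interpolated_at_nodes N P.

(** For [N = n1 + n2 - 2] this linear space contains all three type I vectors, hence all their
    combinations. *)
Definition sizes_mom0 (n1 n2 N : nat) (P : {poly R} * {poly R}) : Prop :=
  [/\ (size P.1 <= n1)%N, (size P.2 <= n2)%N
    & forall k, (k < N)%N -> mom P k = 0].

Definition type_I_mom (n1 n2 : nat) (P : {poly R} * {poly R}) : Prop :=
  [/\ P != (0, 0), sizes_mom0 n1 n2 (n1 + n2 - 1) P
    & (0 < n1 + n2)%N -> mom P (n1 + n2 - 1) = 1].

Let size_comb (a b : R) (p q : {poly R}) n : (size p <= n)%N -> (size q <= n)%N ->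
  (size (a *: p + b *: q)%R <= n)%N.
Proof.
move=> sp sq; rewrite (leq_trans (size_polyD _ _))// geq_max.
by rewrite !(leq_trans (size_scale_leq _ _)).
Qed.

Lemma sizes_mom0_comb a b n1 n2 N P Q : sizes_mom0 n1 n2 N P ->
  sizes_mom0 n1 n2 N Q -> sizes_mom0 n1 n2 N (comb a b P Q).
Proof.
move=> [p1 p2 pN] [q1 q2 qN]; split; [exact: size_comb|exact: size_comb|].
by move=> k kN; rewrite mom_comb pN// qN// !mulr0 addr0.
Qed.

Lemma sizes_mom0_le n1 n2 N m1 m2 K P : (n1 <= m1)%N -> (n2 <= m2)%N ->
  (K <= N)%N -> sizes_mom0 n1 n2 N P -> sizes_mom0 m1 m2 K P.
Proof.
move=> nm1 nm2 KN [p1 p2 pN]; split; [exact: leq_trans nm1|exact: leq_trans nm2|].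
by move=> k kK; rewrite pN// (leq_trans kK).
Qed.

Section Pair.
Variables (n1 n2 : nat) (P Q : {poly R} * {poly R}).
Hypotheses (HP : sizes_mom0 n1 n2 (n1 + n2 - 2) P)
  (HQ : sizes_mom0 n1 n2 (n1 + n2 - 2) Q).
Hypothesis indep : forall a b,
  a *: P.1 + b *: Q.1 = 0 -> a *: P.2 + b *: Q.2 = 0 -> (a, b) = (0, 0).

(** A combination whose second component vanishes also has zero first component, because [1 < n2]
    gives n1 <= n1 + n2 - 2; independence then makes it trivial. Any other combination is covered by
    [interpolated_square_sum_r]. *)
Lemma pair_interlacing_r : (1 < n2)%N -> (n2 <= n1 + 1)%N ->
  interlacing P.2 Q.2.
Proof.
move=> n2_gt1 n21; apply: pencil_interlacing => a b ab u v.
have [s1 s2 /mom_nodes hI] := sizes_mom0_comb a b HP HQ.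
have := interpolated_square_sum_r hI u v s1 s2 n21; rewrite /comb /=; apply.
apply: contraNneq ab => e2.
by rewrite (indep _ e2)//; apply: (interpolated_eq0_r hI) => //; lia.
Qed.

Lemma pair_interlacing_l : (1 < n1)%N -> (n1 + 1 <= n2)%N ->
  interlacing P.1 Q.1.
Proof.
move=> n1_gt1 n12; apply: pencil_interlacing => a b ab u v.
have [s1 s2 /mom_nodes hI] := sizes_mom0_comb a b HP HQ.
have := interpolated_square_sum_l hI u v s1 s2 n12; rewrite /comb /=; apply.
apply: contraNneq ab => e1.
by rewrite (indep e1)//; apply: (interpolated_eq0_l hI) => //; lia.
Qed.

End Pair.

Lemma mom_lin0 a b P Q k : a *: P.1 + b *: Q.1 = 0 -> a *: P.2 + b *: Q.2 = 0 ->
  a * mom P k + b * mom Q k = 0.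
Proof.
move=> e1 e2; rewrite -mom_comb /comb e1 e2.
have := mom_comb 0 0 (0, 0) (0, 0) k.
by rewrite /comb /= !scaler0 !addr0 !mul0r addr0.
Qed.

Variables (n1 n2 : nat) (A Ae1 Ae2 : {poly R} * {poly R}).
Hypotheses (n1_gt0 : (0 < n1)%N) (n2_gt0 : (0 < n2)%N).
Hypotheses (hA : type_I_mom n1 n2 A) (hAe1 : type_I_mom (n1 - 1) n2 Ae1)
  (hAe2 : type_I_mom n1 (n2 - 1) Ae2).

Let VA : sizes_mom0 n1 n2 (n1 + n2 - 2) A.
Proof. by case: hA => _ + _; apply: sizes_mom0_le => //; lia. Qed.

Let VAe1 : sizes_mom0 n1 n2 (n1 + n2 - 2) Ae1.
Proof. by case: hAe1 => _ + _; apply: sizes_mom0_le => //; lia. Qed.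

Let VAe2 : sizes_mom0 n1 n2 (n1 + n2 - 2) Ae2.
Proof. by case: hAe2 => _ + _; apply: sizes_mom0_le => //; lia. Qed.

Let mAe1 : mom Ae1 (n1 + n2 - 2) = 1.
Proof.
case: hAe1 => _ _; have -> : (n1 - 1 + n2 - 1 = n1 + n2 - 2)%N by lia.
by apply; lia.
Qed.

Let mAe2 : mom Ae2 (n1 + n2 - 2) = 1.
Proof.
case: hAe2 => _ _; have -> : (n1 + (n2 - 1) - 1 = n1 + n2 - 2)%N by lia.
by apply; lia.
Qed.

(** The moment of order n1 + n2 - 2 is 0 on [A] and 1 on [Q], so [b = 0]; the next moment is 1 on
    [A], so [a = 0]. *)
Let indepA Q : mom Q (n1 + n2 - 2) = 1 ->
  forall a b, a *: A.1 + b *: Q.1 = 0 -> a *: A.2 + b *: Q.2 = 0 ->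
  (a, b) = (0, 0).
Proof.
move=> mQ a b e1 e2; case: hA => A0 [_ _ m0] /(_ _)/= m1.
have := mom_lin0 (n1 + n2 - 2) e1 e2.
rewrite mQ m0; last by lia.
rewrite mulr0 add0r mulr1 => b0; rewrite b0.
have := mom_lin0 (n1 + n2 - 1) e1 e2.
by rewrite m1 ?addn_gt0 ?n1_gt0// b0 mul0r addr0 mulr1 => ->.
Qed.

Let Ae1_neq_Ae2 : (n2 <= n1 + 1)%N \/ (n1 + 1 <= n2)%N ->
  Ae1 <> Ae2.
Proof.
move=> n12 E; case: hAe1 => /eqP Ae1_neq0 [s1 _ _] _; case: hAe2 => _ [_ s2 _] _.
rewrite -E in s2; rewrite subn1 in s1; rewrite subn1 in s2.
have [t1 t2 /mom_nodes hI] := VAe1; apply: Ae1_neq0.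
have [e1 e2] : Ae1.1 = 0 /\ Ae1.2 = 0.
  case: n12 => n12.
    have e2 := interpolated_small_r hI s1 s2 n2_gt0 n12.
    by split=> //; apply: (interpolated_eq0_r hI) => //; lia.
  have e1 := interpolated_small_l hI s1 s2 n1_gt0 n12.
  by split=> //; apply: (interpolated_eq0_l hI) => //; lia.
by case: Ae1 e1 e2 => ? ? /= -> ->.
Qed.

(** Both vectors have moment 1 at order n1 + n2 - 2, so [a = - b], and a nontrivial relation would
    identify them. *)
Let indepAe a b : (n2 <= n1 + 1)%N \/ (n1 + 1 <= n2)%N ->
  a *: Ae1.1 + b *: Ae2.1 = 0 -> a *: Ae1.2 + b *: Ae2.2 = 0 ->
  (a, b) = (0, 0).
Proof.
move=> n12 e1 e2; have := mom_lin0 (n1 + n2 - 2) e1 e2.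
rewrite mAe1 mAe2 !mulr1 => /eqP; rewrite addr_eq0 => /eqP ab.
have [b0|b0] := eqVneq b 0; first by rewrite ab b0 oppr0.
exfalso; apply: (Ae1_neq_Ae2 n12).
have cancel (p q : {poly R}) : a *: p + b *: q = 0 -> p = q.
  rewrite ab scaleNr addrC => /eqP; rewrite subr_eq0 => /eqP.
  by move=> /(scalerI b0).
by case: Ae1 Ae2 (cancel _ _ e1) (cancel _ _ e2) => ? ? [? ?] /= -> ->.
Qed.

Lemma type_I_mom_interlacing_l : (n1 + 1 <= n2)%N ->
  interlacing A.1 Ae2.1 /\
  ((1 < n1)%N -> interlacing A.1 Ae1.1 /\ interlacing Ae1.1 Ae2.1).
Proof.
move=> n12; split; last first.
  move=> n1_gt1; split; apply: (@pair_interlacing_l n1 n2) => //.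
    exact: indepA.
  by move=> a b; apply: indepAe; right.
have [n1_gt1|n1_le1] := ltnP 1 n1.
  by apply: (@pair_interlacing_l n1 n2) => //; exact: indepA.
have n1E : n1 = 1%N by lia.
(* A single type I vector has one more vanishing moment than the pairs above, so for [n1 = 1] there
   are as many nodes as coefficients of [P.2], and [P.1 = 0] would kill [P.2] as well. *)
have neq0 m P : type_I_mom n1 m P -> P.1 != 0.
  move=> [P0 [_ s2 /mom_nodes hI] _]; apply: contra_neq P0 => P1.
  have P2 : P.2 = 0 by apply: (interpolated_eq0_l hI) => //; lia.
  by case: P P1 P2 {hI s2} => ? ? /= -> ->.
apply: interlacing_const; [exact: neq0 hA|exact: neq0 hAe2|..].
  by case: hA => _ []; rewrite n1E.
by case: hAe2 => _ []; rewrite n1E.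
Qed.

Lemma type_I_mom_interlacing_r : (n2 <= n1 + 1)%N ->
  interlacing A.2 Ae1.2 /\
  ((1 < n2)%N -> interlacing A.2 Ae2.2 /\ interlacing Ae1.2 Ae2.2).
Proof.
move=> n12; split; last first.
  move=> n2_gt1; split; apply: (@pair_interlacing_r n1 n2) => //.
    exact: indepA.
  by move=> a b; apply: indepAe; left.
have [n2_gt1|n2_le1] := ltnP 1 n2.
  by apply: (@pair_interlacing_r n1 n2) => //; exact: indepA.
have n2E : n2 = 1%N by lia.
have neq0 m P : type_I_mom m n2 P -> P.2 != 0.
  move=> [P0 [s1 _ /mom_nodes hI] _]; apply: contra_neq P0 => P2.
  have P1 : P.1 = 0 by apply: (interpolated_eq0_r hI) => //; lia.
  by case: P P1 P2 {hI s1} => ? ? /= -> ->.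
apply: interlacing_const; [exact: neq0 hA|exact: neq0 hAe1|..].
  by case: hA => _ []; rewrite n2E.
by case: hAe1 => _ []; rewrite n2E.
Qed.

End MomentFunctional.

(** * Sign changes on a set, or a polynomial with the same sign pattern *)

Section SignChanges.
Variable R : realType.
Implicit Types (F : R -> R) (J : set R) (y : nat -> R).

Definition alternating N F J y : Prop :=
  (forall i, (i < N)%N -> J (y i) /\ 0 < (-1) ^+ i * F (y i)) /\
  (forall i, (i.+1 < N)%N -> y i < y i.+1).

Lemma alternating_cons N F J y s : J s -> 0 < F s ->
  ((0 < N)%N -> s < y 0%N) -> alternating N (fun x => - F x) J y ->
  alternating N.+1 F J (fun i => if i is k.+1 then y k else s).
Proof.
move=> Js Fs sy [yJ yy]; split => [[_|i]|[|i]]; rewrite ?ltnS //.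
- by rewrite expr0 mul1r.
- by move=> /yJ; rewrite exprS mulrN mulN1r mulNr.
- exact: yy.
Qed.

(* The condition at the lower bounds of J is what makes the induction work: it
   fixes the sign of q to the left of its roots. *)
Lemma alternating_or_poly N F J : (exists y, alternating N F J y) \/
  exists q : {poly R}, [/\ q != 0, (size q <= N)%N,
    forall x, J x -> q.[x] * F x <= 0 &
    forall x, (forall z, J z -> x <= z) -> 0 <= q.[x]].
Proof.
elim: N F J => [|N IH] F J; first by left; exists (fun=> 0); split.
pose S := [set x | J x /\ 0 < F x].
have [[s0 Ss0]|S0] := pselect (exists s, S s); last first.
  right; exists 1; rewrite oner_eq0 size_poly1; split => // x Jx; rewrite hornerC ?mul1r//.
  by rewrite leNgt; apply/negP => Fx; apply: S0; exists x.
(* Recurse on [- F] over the points to the right of some positive point: an alternation found there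
   can be prefixed by such a point. *)
pose J' := [set x | J x /\ exists2 s, S s & s < x].
have [[y Hy]|[q [q0 sq qF qlb]]] := IH (fun x => - F x) J'.
  left; have [s [Js Fs] sy] : exists2 s, S s & ((0 < N)%N -> s < y 0%N).
    have [_|N0] := posnP N; first by exists s0.
    by have [[_ [s Ss sy]] _] := Hy.1 _ N0; exists s.
  exists (fun i => if i is k.+1 then y k else s); apply: alternating_cons => //.
  by case: Hy => yJ yy; split=> // i /yJ[[]].
have {}qF x : J' x -> 0 <= q.[x] * F x.
  by move=> /qF; rewrite mulrN oppr_le0.
have [[b Sb]|unb] := pselect (exists b, forall s, S s -> b <= s); last first.
  (* Positive points are unbounded below: [J'] is all of [J], no new zero is needed, and the
     condition at lower bounds is vacuous. *)
  have J'J x : J x -> J' x.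
    move=> Jx; split=> //; apply: contrapT => nx; apply: unb; exists x => s Ss.
    by rewrite leNgt; apply/negP => sx; apply: nx; exists s.
  right; exists (- q); rewrite oppr_eq0 size_polyN (leq_trans sq)//; split => //.
    by move=> x /J'J/qF; rewrite hornerN mulNr oppr_le0.
  by move=> x lb; exfalso; apply: unb; exists x => s [/lb].
have hinf : has_inf S by split; [exists s0|exists b].
pose a := inf S.
have aS s : S s -> a <= s by move=> Ss; apply: inf_lbound => //; case: hinf.
have lea x : (forall s, S s -> x <= s) -> x <= a.
  by move=> xS; apply: lb_le_inf; [exists s0|].
(* The new zero sits at the infimum [a] of the positive points: left of it [F] is nonpositive and
   both factors are nonnegative, right of it the first factor flips the sign. *)
right; exists ((a%:P - 'X) * q); split.
- by rewrite mulf_neq0// -opprB oppr_eq0 polyXsubC_eq0.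
- rewrite -opprB mulNr size_polyN size_monicM ?monicXsubC// size_XsubC.
  by rewrite addSn addSn.
- move=> x Jx; rewrite !hornerE -mulrA.
  have [[s Ss sx]|nx] := pselect (exists2 s, S s & s < x).
    have ax : a - x <= 0 by rewrite subr_le0 (le_trans (aS _ Ss))// ltW.
    by rewrite mulr_le0_ge0// qF//; split => //; exists s.
  have xS s : S s -> x <= s.
    by move=> Ss; rewrite leNgt; apply/negP => sx; apply: nx; exists s.
  have xa := lea _ xS.
  have qx : 0 <= q.[x].
    by apply: qlb => z [_ [s /xS xs sz]]; rewrite (le_trans xs)// ltW.
  have [Fx|Fx] := leP (F x) 0.
    by rewrite mulr_ge0_le0 ?subr_ge0// mulr_ge0_le0.
  have -> : x = a by apply/le_anti; rewrite xa aS.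
  by rewrite subrr mul0r.
- move=> x xJ; rewrite !hornerE mulr_ge0//.
    by rewrite subr_ge0 lea// => s [/xJ].
  by apply: qlb => z [/xJ].
Qed.

(** Take one alternation starting positive and one starting negative; whichever begins further left
    lends its first point to the other, giving [N.+1] points. [e] records the starting sign. *)
Lemma sign_changes_or_poly N F J : (0 < N)%N ->
  (exists y (e : bool), alternating N.+1 (fun x => (-1) ^+ e * F x) J y) \/
  exists q : {poly R}, [/\ q != 0, (size q <= N)%N &
    forall x, J x -> 0 <= q.[x] * F x].
Proof.
move=> N0; have [[y Hy]|[q [q0 sq qF _]]] := alternating_or_poly N F J; last first.
  right; exists (- q); rewrite oppr_eq0 size_polyN; split => // x /qF.
  by rewrite hornerN mulNr oppr_ge0.
have [[z Hz]|[q [q0 sq qF _]]] := alternating_or_poly N (fun x => - F x) J; last first.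
  by right; exists q; split => // x /qF; rewrite mulrN oppr_le0.
have [Jy0] := Hy.1 _ N0; rewrite expr0 mul1r => Fy0.
have [Jz0] := Hz.1 _ N0; rewrite expr0 mul1r => Fz0.
left; have [yz|zy|yz] := ltgtP (y 0%N) (z 0%N).
- exists (fun i => if i is k.+1 then z k else y 0%N), false.
  by apply: alternating_cons => //; rewrite ?expr0 ?mul1r//;
    rewrite (_ : (fun _ => _) = (fun x => - F x))//; apply/funext => x; rewrite mul1r.
- exists (fun i => if i is k.+1 then y k else z 0%N), true.
  by apply: alternating_cons => //; rewrite ?expr1 ?mulN1r//;
    rewrite (_ : (fun _ => _) = F)//; apply/funext => x; rewrite mulN1r opprK.
- by move: Fz0; rewrite -yz oppr_gt0 => /(lt_trans Fy0); rewrite ltxx.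
Qed.

(** The intermediate value theorem puts a zero strictly between consecutive points of an alternation
    of length [N.+1]. *)
Lemma zeros_or_poly N F J : is_interval J -> {in J, continuous F} ->
  (exists x : nat -> R,
     (forall i, (i < N)%N -> J (x i) /\ F (x i) = 0) /\
     (forall i j, (i < j)%N -> (j < N)%N -> x i < x j)) \/
  exists q : {poly R}, [/\ q != 0, (size q <= N)%N &
    forall x, J x -> 0 <= q.[x] * F x].
Proof.
move=> itvJ cF; have [->|N0] := posnP N; first by left; exists (fun=> 0).
have [[y [e [yJ yy]]]|] := sign_changes_or_poly F J N0; last by right.
left; have /choice[x xP] : forall i, exists x, (i < N)%N ->
    [/\ J x, F x = 0 & y i < x < y i.+1].
  move=> i; have [iN|] := boolP (i < N)%N; last by exists 0.
  have [Jy1 Fy1] := yJ i (ltnW iN : (i < N.+1)%N).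
  have [Jy2 Fy2] := yJ i.+1 (iN : (i.+1 < N.+1)%N).
  have y12 := yy i (iN : (i.+1 < N.+1)%N).
  have sub : `[y i, y i.+1]%classic `<=` J.
    by move=> t /=; rewrite in_itv/= => /itvJ; apply.
  have cF' : {within `[y i, y i.+1], continuous F}.
    apply: continuous_in_subspaceT => t; rewrite inE => /sub Jt.
    by apply: cF; rewrite inE.
  have FF : F (y i) * F (y i.+1) < 0.
    have := mulr_gt0 Fy1 Fy2; rewrite exprS.
    set a := (-1) ^+ e; set b := (-1) ^+ i.
    have -> : b * (a * F (y i)) * (-1 * b * (a * F (y i.+1))) =
      (a ^+ 2) * (b ^+ 2) * - (F (y i) * F (y i.+1)) by ring.
    by rewrite /a /b !sqrr_sign !mul1r oppr_gt0.
  have [|t tab Ft] := @IVT R F (y i) (y i.+1) 0 (ltW y12) cF'.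
    have [F1|F1|F1] := ltgtP (F (y i)) 0.
    - have F2 : 0 < F (y i.+1) by move: FF; rewrite nmulr_rlt0.
      by rewrite ge_min le_max (ltW F1) (ltW F2) orbT.
    - have F2 : F (y i.+1) < 0 by move: FF; rewrite pmulr_rlt0.
      by rewrite ge_min le_max (ltW F1) (ltW F2) orbT.
    - by move: FF; rewrite F1 mul0r ltxx.
  exists t => _; split => //; first by apply: sub.
  have yt : y i != t by apply: contraTneq FF => ->; rewrite Ft mul0r ltxx.
  have ty : t != y i.+1 by apply: contraTneq FF => <-; rewrite Ft mulr0 ltxx.
  by move: tab; rewrite in_itv/= => /andP[h1 h2]; rewrite !lt_neqAle yt ty h1 h2.
exists x; split => [i /xP[]//|i j ij jN].
have y_mono k l : (k <= l)%N -> (l < N.+1)%N -> y k <= y l.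
  move=> kl; rewrite -(subnKC kl); elim: (l - k)%N => [|d IH]; first by rewrite addn0.
  by rewrite addnS => dN; rewrite (le_trans (IH (ltnW dN)))// ltW// yy.
have [_ _ /andP[_ h1]] := xP i (ltn_trans ij jN).
have [_ _ /andP[h2 _]] := xP j jN.
by rewrite (lt_trans h1)// (le_lt_trans _ h2)// y_mono// ltnW.
Qed.

End SignChanges.

(** * Supports of measures and strict positivity of integrals *)

Section Support.
Variable R : realType.
Variable mu : {finite_measure set (measurableTypeR R) -> \bar R}.

Definition msupport : set R := [set x | forall U : set R, open U -> U x -> mu U != 0%E].

(** Each point of [O] lies in a null interval with rational endpoints, and there are countably many
    of these. *)
Lemma open_disjoint_support_null (O : set R) : open O -> O `&` msupport = set0 ->
  mu O = 0%E.
Proof.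
move=> oO Os; apply: measure_negligible; first exact: open_measurable.
pose I (pq : rat * rat) : set R := `]ratr pq.1, ratr pq.2[%classic.
pose F n : set R := if unpickle n is Some pq then
  if mu (I pq) == 0%E then I pq else set0 else set0.
apply: (@negligibleS _ _ _ mu (\bigcup_n F n)); last first.
  apply: negligible_bigcup => n; rewrite /F; case: unpickle => [pq|]; last exact: negligible_set0.
  case: eqP => [mI|_]; last exact: negligible_set0.
  by exists (I pq); split => //; exact: measurable_itv.
move=> x Ox.
have : ~ msupport x.
  by move=> sx; have : (O `&` msupport) x by []; rewrite Os.
move=> /existsNP[U /not_implyP[oU /not_implyP[Ux /negP/negPn/eqP mU]]].
have /nbhs_ballP[e /= e0 eU] : nbhs x U by exact: open_nbhs_nbhs.
have xe1 : x - e < x by rewrite ltrBlDr ltrDl.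
have xe2 : x < x + e by rewrite ltrDl.
have [p] := rat_in_itvoo xe1.
rewrite in_itv/= => /andP[p1 p2].
have [q] := rat_in_itvoo xe2.
rewrite in_itv/= => /andP[q1 q2].
have mI : mu (I (p, q)) = 0%E.
  apply/eqP; rewrite -measure_le0 -mU; apply: le_measure; rewrite ?inE.
  - exact: measurable_itv.
  - exact: open_measurable.
  move=> t; rewrite /I/= in_itv/= => /andP[t1 t2]; apply: eU.
  rewrite /ball/= ltr_norml; lra.
have FE : F (pickle (p, q)) = I (p, q) by rewrite /F pickleK mI eqxx.
exists (pickle (p, q)); first exact: Logic.I.
by rewrite FE /I/= in_itv/= p2 q1.
Qed.

Section FullMeasure.
Variable D : set (measurableTypeR R).
Hypotheses (mD : measurable D) (D0 : mu (~` D) = 0%E).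

Lemma Rintegral_full_measure (f : R -> R) : mu.-integrable setT (EFin \o f) ->
  \int[mu]_(x in setT) f x = \int[mu]_(x in D) f x.
Proof.
move=> fi; rewrite /Rintegral (negligible_integral (measurableC mD))//.
by rewrite setTD setCK.
Qed.

(** A zero integral would make [h] vanish almost everywhere on [D], but [h] is positive on [D] in a
    neighbourhood of [x0], which has non-zero measure while the complement of [D] is null. *)
Lemma Rintegral_gt0 (h : R -> R) (x0 : R) :
  mu.-integrable D (EFin \o h) -> (forall x, D x -> 0 <= h x) ->
  msupport x0 -> (\forall x \near x0, D x -> 0 < h x) ->
  0 < \int[mu]_(x in D) h x.
Proof.
move=> hiD h0 x0s hx0; pose U := [set x | D x -> 0 < h x]°.
have oU : open U by exact: open_interior.
have hU x : U x -> D x -> 0 < h x by move=> /interior_subset.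
have mU := x0s U oU hx0.
rewrite lt_neqAle Rintegral_ge0// andbT; apply: contraNN mU => /eqP e.
have e0 : (\int[mu]_(x in D) `|(h x)%:E| = 0)%E.
  transitivity (\int[mu]_(x in D) (EFin \o h) x)%E.
    by apply: eq_integral => x; rewrite inE => Dx; rewrite /= ger0_norm// h0.
  rewrite -(fineK (integrable_fin_num mD hiD)); congr (_%:E); exact/esym/e.
have mh : measurable_fun D (EFin \o h) by case/integrableP : hiD.
have [N [mN N0 DN]] := (ae_eq_integral_abs mu mD mh).1 e0.
rewrite -measure_le0; apply: (@le_trans _ _ (mu (N `|` ~` D))).
  apply: le_measure; rewrite ?inE//.
  - exact: open_measurable.
  - by apply: measurableU => //; exact: measurableC.
  move=> x Ux; have [Dx|] := pselect (D x); last by right.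
  left; apply: DN => /= /(_ Dx) [hx].
  by have := hU _ Ux Dx; rewrite hx ltxx.
apply: (le_trans (measureU2 _ mN (measurableC mD))).
by move: N0 D0 => /= -> ->; rewrite adde0.
Qed.

End FullMeasure.

(* Finiteness of the integral rules out the convention +oo - oo = -oo. *)
Lemma fin_num_integrable (D : set (measurableTypeR R)) (f : R -> \bar R) :
  measurable D -> measurable_fun D f -> (\int[mu]_(x in D) f x \is a fin_num)%E ->
  mu.-integrable D f.
Proof.
move=> mD mf; rewrite integralE fin_numB => /andP[fp fn].
apply/integrableP; split => //.
have -> : (\int[mu]_(x in D) `|f x| = \int[mu]_(x in D) (f^\+ x + f^\- x))%E.
  by apply: eq_integral => x _; exact: (congr1 (@^~ x) (fune_abse f)).
rewrite ge0_integralD//.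
- by rewrite lte_add_pinfty// ltey_eq ?fp ?fn.
- exact: measurable_funepos.
- exact: measurable_funeneg.
Qed.

Lemma integral_null_set (D : set (measurableTypeR R)) (f : R -> \bar R) :
  measurable D -> mu D = 0%E -> (\int[mu]_(x in D) f x = 0)%E.
Proof.
move=> mD D0; rewrite (eq_measure_integral mzero) ?integral_measure_zero//.
move=> A mA AD; apply/eqP; rewrite -measure_le0 -D0.
by apply: le_measure; rewrite ?inE.
Qed.

End Support.

(** * The Cauchy transform of a measure carried by a half-line *)

Section StieltjesTransform.
Variable R : realType.

Lemma measurable_cauchy_kernel (x : R) : measurable_fun setT (fun t : R => (t - x)^-1).
Proof.
rewrite -(setvU [set x]); apply/measurable_funU.
- by apply: measurableC; exact: measurable_set1.
- exact: measurable_set1.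
- split; last exact: measurable_fun_set1.
  apply: open_continuous_measurable_fun.
    by apply: closed_openC; exact: closed_eq.
  move=> t; rewrite inE/= => /eqP tx; apply: cvgV; first by rewrite subr_eq0.
  by apply: cvgB; [exact: cvg_id|exact: cvg_cst].
Qed.

Variable nu : {finite_measure set (measurableTypeR R) -> \bar R}.
Variables (e c : R).
Hypothesis e_sign : e = 1 \/ e = -1.

(** The sign [e] selects the half-line to the right or to the left of [c], so both relative
    positions of the supports are treated at once. *)
Definition ray : set R := [set t | 0 <= e * (t - c)].

Lemma closed_ray : closed ray.
Proof.
rewrite (_ : ray = (fun t => e * (t - c)) @^-1` [set x | 0 <= x])//.
apply: closed_comp; last exact: closed_ge.
move=> t _; apply: cvgM; first exact: cvg_cst.
by apply: cvgB; [exact: cvg_id|exact: cvg_cst].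
Qed.

Lemma measurable_ray : measurable (ray : set (measurableTypeR R)).
Proof. by apply: closed_measurable; exact: closed_ray. Qed.

Hypothesis nu_ray : nu (~` ray) = 0%E.

Definition cauchy_transform (x : R) : R := \int[nu]_(t in ray) (t - x)^-1.

Let ee : e * e = 1.
Proof. by case: e_sign => ->; rewrite ?mulr1// mulrNN mulr1. Qed.

Let normrE (x : R) : 0 <= e * x -> `|x| = e * x.
Proof.
case: e_sign => ->; first by rewrite mul1r => /ger0_norm.
by rewrite mulN1r oppr_ge0 => /ler0_norm.
Qed.

(** The first bound dominates the kernel by a constant when x is off the ray; the second dominates
    it by the kernel at [c], uniformly in x. *)
Lemma ray_dist (x t : R) : e * (x - c) <= 0 -> ray t ->
  e * (c - x) <= `|t - x| /\ `|t - c| <= `|t - x|.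
Proof.
rewrite /ray/= => xc tc.
have cx : 0 <= e * (c - x) by move: xc; rewrite -oppr_ge0 -mulrN opprB.
have E : e * (t - x) = e * (t - c) + e * (c - x) by ring.
have tx : 0 <= e * (t - x) by rewrite E addr_ge0.
by rewrite !normrE// E; split; rewrite ?lerDl ?lerDr.
Qed.

Lemma cauchy_kernel_integrable (x : R) : e * (x - c) < 0 ->
  nu.-integrable ray (EFin \o (fun t => (t - x)^-1)).
Proof.
move=> xc; have cx : 0 < e * (c - x) by move: xc; rewrite -oppr_gt0 -mulrN opprB.
apply: (le_integrable measurable_ray _ _
  (finite_measure_integrable_cst nu (e * (c - x))^-1 measurable_ray)).
  by apply: measurable_funTS; apply/measurable_EFinP; exact: measurable_cauchy_kernel.
move=> t /(ray_dist (ltW xc))[d _]; rewrite /= lee_fin normfV.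
have tx : 0 < `|t - x| by exact: lt_le_trans d.
by rewrite [X in _ <= X]ger0_norm; [rewrite lef_pV2|rewrite invr_ge0 ltW].
Qed.

Lemma cauchy_transform_continuous (x : R) : e * (x - c) < 0 ->
  {for x, continuous cauchy_transform}.
Proof.
move=> xc; have cx : 0 < e * (c - x) by move: xc; rewrite -oppr_gt0 -mulrN opprB.
(* Half the distance from [x] to [c]: on the [d]-neighbourhood of [x] the kernel is bounded by
   [d^-1]. *)
pose d := e * (c - x) / 2; have d0 : 0 < d by rewrite divr_gt0.
have Id y : y \in `]x - d, x + d[ -> d <= e * (c - y) /\ e * (y - c) < 0.
  rewrite in_itv/= /d => /andP[y1 y2].
  have H : e * (c - x) / 2 <= e * (c - y).
    by case: e_sign y1 y2 => ->; lra.
  split => //; rewrite -oppr_gt0 -mulrN opprB (lt_le_trans _ H)//.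
apply: (@continuity_under_integral R _ _ nu (fun y t => (t - y)^-1) ray
  measurable_ray (x - d) (x + d) _ _ (cst d^-1)).
- by move=> y /mem_set; rewrite inE => /Id[_]; exact: cauchy_kernel_integrable.
- apply: aeW => t /= rt y; rewrite inE => /Id[dy yc].
  apply: cvgV; last by apply: cvgB; [exact: cvg_cst|exact: cvg_id].
  have [h _] := ray_dist (ltW yc) rt.
  by rewrite -normr_gt0 (lt_le_trans _ h)// (lt_le_trans d0).
- exact: (finite_measure_integrable_cst nu _ measurable_ray).
- move=> y Iy; apply: aeW => t rt.
  have [dy yc] := Id y Iy; have [h _] := ray_dist (ltW yc) rt.
  by rewrite normfV lef_pV2 ?posrE//; rewrite ?(lt_le_trans _ h) ?(le_trans dy)// (lt_le_trans d0).
- by rewrite inE/= in_itv/= ltrBlDr !ltrDl d0.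
Qed.

(** Dominated convergence with the kernel at [c] as majorant; the absence of an atom at [c] gives
    pointwise convergence almost everywhere. *)
Lemma cauchy_transform_endpoint : nu [set c] = 0%E ->
  nu.-integrable ray (EFin \o (fun t => (t - c)^-1)) ->
  (fun n => cauchy_transform (c - e * n.+1%:R^-1)) @ \oo --> cauchy_transform c.
Proof.
move=> nuc ic.
pose x (n : nat) := c - e * n.+1%:R^-1.
have xc n : e * (x n - c) < 0.
  by rewrite /x addrAC subrr sub0r mulrN mulrA ee mul1r oppr_lt0.
have aec (P : R -> Prop) : (forall t, t != c -> P t) -> {ae nu, forall t, P t}.
  move=> h; exists [set c]; split => //.
  by move=> t /= nP; apply: contrapT => /eqP /h.
have [] := @dominated_convergence _ _ _ nu ray measurable_ray
  (fun n t => ((t - x n)^-1)%:E) (fun t => ((t - c)^-1)%:E)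
  (fun t => `|((t - c)^-1)%:E|)%E.
- move=> n; apply: measurable_funTS; apply/measurable_EFinP.
  exact: measurable_cauchy_kernel.
- apply: measurable_funTS; apply/measurable_EFinP.
  exact: measurable_cauchy_kernel.
- apply: aec => t tc _; apply: cvg_EFin; first exact: nearW.
  apply: cvgV; first by rewrite subr_eq0.
  apply: cvgB; first exact: cvg_cst.
  rewrite /x -[X in _ --> X]subr0 -(mulr0 e); apply: cvgB; first exact: cvg_cst.
  by apply: cvgM; [exact: cvg_cst|exact: cvg_harmonic].
- exact: integrable_abse.
- apply: aec => t tc n rt; rewrite /= lee_fin !normfV.
  have [_ h] := ray_dist (ltW (xc n)) rt.
  have tc0 : 0 < `|t - c| by rewrite normr_gt0 subr_eq0.
  by rewrite lef_pV2 ?posrE// (lt_le_trans tc0).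
move=> _ _ h; rewrite /cauchy_transform /Rintegral.
apply: fine_cvg; rewrite fineK; last exact: (integrable_fin_num measurable_ray ic).
exact: h.
Qed.

End StieltjesTransform.

(** * Comparison of the extended-real and real-valued transforms *)

Section ExtendedKernel.
Variable R : realType.

Lemma inve_kernel (x t : R) : t != x -> ((t - x)%:E^-1)%E = ((t - x)^-1)%:E.
Proof. by move=> tx; rewrite inver subr_eq0 (negPf tx). Qed.

Lemma measurable_inve_kernel (x : R) :
  measurable_fun setT (fun t : R => ((t - x)%:E^-1)%E).
Proof.
rewrite -(setvU [set x]); apply/measurable_funU.
- by apply: measurableC; exact: measurable_set1.
- exact: measurable_set1.
- split; last exact: measurable_fun_set1.
  apply: (eq_measurable_fun (EFin \o (fun t : R => (t - x)^-1))).
    by move=> t; rewrite inE/= => /eqP tx; rewrite inve_kernel.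
  apply: measurable_funTS; apply/measurable_EFinP.
  exact: measurable_cauchy_kernel.
Qed.

Variable s : cs_measure R.
Variables (e c : R).
Hypothesis e_sign : e = 1 \/ e = -1.
Let nu := cs_abs s.
Hypothesis nu_ray : nu (~` ray e c) = 0%E.

Let mray : measurable (ray e c : set (measurableTypeR R)).
Proof. exact: measurable_ray. Qed.

Let mx (x : R) : measurable ([set x] : set (measurableTypeR R)).
Proof. exact: measurable_set1. Qed.

(** The two kernels differ only at t = x, a null point, and the complement of the ray is null
    too. *)
Lemma stieltjes_integrable (x : R) : nu [set x] = 0%E ->
  (nu.-integrable setT (fun t => (t - x)%:E^-1)%E <->
   nu.-integrable (ray e c) (EFin \o (fun t => (t - x)^-1))) /\
  (nu.-integrable setT (fun t => (t - x)%:E^-1)%E ->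
   stieltjes s x = (cs_sign s * cauchy_transform nu e c x)%:E).
Proof.
move=> nux.
have mH : measurable_fun setT (fun t : R => ((t - x)%:E^-1)%E).
  exact: measurable_inve_kernel.
have mk : measurable_fun (ray e c) (EFin \o (fun t : R => (t - x)^-1)).
  by apply: measurable_funTS; apply/measurable_EFinP; exact: measurable_cauchy_kernel.
have mE : measurable (ray e c `\` [set x] : set (measurableTypeR R)).
  exact: measurableD.
have eqk : {in ray e c `\` [set x], (fun t : R => ((t - x)%:E^-1)%E) =1
    EFin \o (fun t : R => (t - x)^-1)}.
  by move=> t; rewrite inE => -[_ /eqP tx]; rewrite inve_kernel.
have mC := measurableC mray.
have iTE : nu.-integrable setT (fun t => (t - x)%:E^-1)%E <->
    nu.-integrable (ray e c) (EFin \o (fun t => (t - x)^-1)).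
  rewrite (negligible_integrable mC measurableT mH nu_ray) setTD setCK.
  have mHr : measurable_fun (ray e c) (fun t : R => ((t - x)%:E^-1)%E).
    exact: measurable_funTS.
  rewrite (negligible_integrable (mx x) mray mHr nux).
  rewrite (negligible_integrable (mx x) mray mk nux).
  by split; apply: eq_integrable => // t /eqk ->.
split => // iT; rewrite /stieltjes /cs_eintegral EFinM; congr (_ * _)%E.
have ik := iTE.1 iT.
rewrite /cauchy_transform /Rintegral fineK; last first.
  exact: (integrable_fin_num mray ik).
rewrite (negligible_integral mC measurableT iT nu_ray) setTD setCK.
have iR : nu.-integrable (ray e c) (fun t => (t - x)%:E^-1)%E.
  by apply: integrableS iT.
rewrite (negligible_integral (mx x) mray iR nux).
rewrite [RHS](negligible_integral (mx x) mray ik nux).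
by apply: eq_integral.
Qed.

Lemma stieltjes_off_ray (x : R) : e * (x - c) < 0 ->
  stieltjes s x = (cs_sign s * cauchy_transform nu e c x)%:E.
Proof.
move=> xc; have nux : nu [set x] = 0%E.
  apply/eqP; rewrite -measure_le0 -nu_ray; apply: le_measure; rewrite ?inE.
  - exact: mx.
  - exact: measurableC.
  - by move=> _ ->; rewrite /ray/= leNgt; apply/negP; rewrite negbK.
have [i1 i2] := stieltjes_integrable nux.
apply: i2; apply/i1.
exact: cauchy_kernel_integrable.
Qed.

(** A finite value means an integrable kernel, hence one finite almost everywhere; its value +oo at
    t = x then excludes an atom there. *)
Lemma stieltjes_fin_num (x : R) : (stieltjes s x \is a fin_num)%E ->
  [/\ nu [set x] = 0%E,
     nu.-integrable (ray e c) (EFin \o (fun t => (t - x)^-1)) &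
     stieltjes s x = (cs_sign s * cauchy_transform nu e c x)%:E].
Proof.
move=> fs.
have iT : nu.-integrable setT (fun t => (t - x)%:E^-1)%E.
  apply: fin_num_integrable => //; first exact: measurable_inve_kernel.
  move: fs; rewrite /stieltjes /cs_eintegral /cs_sign -/nu.
  case: (cs_neg s); first by rewrite expr1 EFinN mulN1e fin_numN.
  by rewrite expr0 mul1e.
have nux : nu [set x] = 0%E.
  have [N [mN N0 sN]] := integrable_ae measurableT iT.
  apply/eqP; rewrite -measure_le0 -N0; apply: le_measure; rewrite ?inE//.
  by move=> _ ->; apply: sN => /= /(_ Logic.I); rewrite subrr inve0.
have [i1 i2] := stieltjes_integrable nux.
by split => //; [apply/i1|exact: i2].
Qed.

End ExtendedKernel.

(** * Integration against a measure given by a density *)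

Section Density.
Variable R : realType.
Variables (rho tau : {finite_measure set (measurableTypeR R) -> \bar R}).
Variables (r : R) (G : R -> \bar R) (g : R -> R) (D : set (measurableTypeR R)).
Hypotheses (r_sign : r * r = 1) (mD : measurable D) (rhoD : rho (~` D) = 0%E).
Hypotheses (mg : measurable_fun D g) (Gg : forall x, D x -> G x = (g x)%:E).
Hypothesis tauE : forall B, measurable B -> tau B = (r%:E * \int[rho]_(x in B) G x)%E.

Let r0 : r != 0.
Proof. by apply: contra_eq_neq r_sign => ->; rewrite mul0r eq_sym oner_eq0. Qed.

Let tau_rho : tau `<< rho.
Proof.
apply/null_content_dominatesP => A mA A0.
by rewrite tauE// integral_null_set// mule0.
Qed.

Let G_g (E : set (measurableTypeR R)) : E `<=` D ->
  (\int[rho]_(x in E) G x = \int[rho]_(x in E) (g x)%:E)%E.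
Proof. by move=> ED; apply: eq_integral => x; rewrite inE => /ED/Gg. Qed.

Let intG (E : set (measurableTypeR R)) : measurable E ->
  (\int[rho]_(x in E) G x = r%:E * tau E)%E.
Proof. by move=> mE; rewrite tauE// muleA -EFinM r_sign mul1e. Qed.

Let ig : rho.-integrable D (EFin \o g).
Proof.
apply: fin_num_integrable => //; first exact/measurable_EFinP.
by rewrite -G_g// intG// fin_numM// fin_num_measure.
Qed.

Let f := Radon_Nikodym_SigmaFinite.f tau rho.

Let f_int : rho.-integrable setT f.
Proof. exact: Radon_Nikodym_SigmaFinite.f_integrable. Qed.

(** Both functions have the same integrals over measurable subsets of [D], which identifies the
    Radon-Nikodym derivative and allows a change of variables. *)
Let fg : ae_eq rho D f (fun x => (r * g x)%:E).
Proof.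
apply: integral_ae_eq => //.
- by apply: integrableS f_int.
- by apply/measurable_EFinP; apply: measurable_funM.
move=> E ED mE; rewrite -Radon_Nikodym_SigmaFinite.f_integral//.
under eq_integral do rewrite EFinM.
rewrite integralZl//; last by apply: integrableS ig.
by rewrite -G_g// -tauE.
Qed.

Let ae_g (p : R -> R) :
  ae_eq rho D (fun x => (p x)%:E * f x)%E (fun x => (r * (p x * g x))%:E).
Proof.
apply: filterS fg => x /= h Dx; rewrite h// -EFinM; congr (_%:E); ring.
Qed.

Let int_f (p : R -> R) : tau.-integrable setT (EFin \o p) ->
  rho.-integrable setT (fun x => (p x)%:E * f x)%E.
Proof.
move=> ip; have := Radon_Nikodym_SigmaFinite.integrableM tau_rho
  (fun x => abse_ge0 (p x)%:E) measurableT (integrable_abse ip).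
apply: le_integrable => //.
  apply: emeasurable_funM; first by case/integrableP: ip.
  by case/integrableP: f_int.
move=> x _; rewrite !abseM; apply: lee_pmul => //; first by rewrite abse_id.
Qed.

Lemma density_integrable (p : R -> R) : tau.-integrable setT (EFin \o p) ->
  rho.-integrable D (EFin \o (fun x => p x * g x)).
Proof.
move=> ip; have /integrableP[mp _] := ip.
have mpD : measurable_fun D p by apply: measurable_funTS; exact/measurable_EFinP.
have mpg : measurable_fun D (fun x => r * (p x * g x)).
  by apply: measurable_funM => //; apply: measurable_funM.
have irpg : rho.-integrable D (EFin \o (fun x => r * (p x * g x))).
  apply/integrableP; split; first exact/measurable_EFinP.
  have /integrableP[mpf lt] : rho.-integrable D (fun x => (p x)%:E * f x)%E.
    by apply: integrableS (int_f ip).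
  apply: le_lt_trans lt; rewrite le_eqVlt; apply/orP; left; apply/eqP.
  apply: ae_eq_integral => //.
  - by apply: measurableT_comp => //; exact/measurable_EFinP.
  - exact: measurableT_comp.
  - by apply: filterS (ae_g p) => x /= h Dx; rewrite h.
apply: (eq_integrable mD (fun x => (r%:E * (r * (p x * g x))%:E)%E)) => //.
  by move=> x _; rewrite -EFinM (mulrA r r) r_sign mul1r.
exact: integrableZl.
Qed.

Lemma density_Rintegral (p : R -> R) : tau.-integrable setT (EFin \o p) ->
  \int[tau]_(x in setT) p x = r * \int[rho]_(x in D) (p x * g x).
Proof.
move=> ip; have /integrableP[mp _] := ip.
have mpD : measurable_fun D p by apply: measurable_funTS; exact/measurable_EFinP.
have mf : measurable_fun setT f by case/integrableP: f_int.
rewrite -RintegralZl//; last exact: density_integrable.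
rewrite /Rintegral; congr fine.
rewrite -(Radon_Nikodym_change_of_variables tau_rho measurableT ip).
transitivity (\int[rho]_x ((p x)%:E * f x))%E.
  apply: ae_eq_integral => //.
  - by apply: emeasurable_funM => //.
  - by apply: emeasurable_funM.
  - apply: ae_eqe_mul2l; apply: ae_eq_sym.
    exact: ae_eq_Radon_Nikodym_SigmaFinite.
rewrite (negligible_integral (measurableC mD) measurableT (int_f ip) rhoD) setTD setCK.
apply: ae_eq_integral => //.
- by apply: measurable_funTS; apply: emeasurable_funM.
- by apply/measurable_EFinP; apply: measurable_funM => //; apply: measurable_funM.
Qed.

End Density.

(** * Separating two intervals with disjoint interiors *)

Section Separation.
Variable R : realType.
Implicit Types Gamma : set R.

Lemma between_interior Gamma (a b z : R) : is_interval Gamma ->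
  Gamma a -> Gamma b -> a < z -> z < b -> Gamma° z.
Proof.
move=> iG Ga Gb az zb.
have oab : open `]a, b[%classic by exact: itv_open.
apply: filterS (open_nbhs_nbhs (conj oab _)).
- by move=> t /=; rewrite in_itv/= => /andP[at_ tb]; apply: (iG a b) => //; rewrite !ltW.
- by rewrite /= in_itv/= az zb.
Qed.

Lemma infinite_interval_interior Gamma : is_interval Gamma ->
  infinite_set Gamma -> exists u, Gamma° u.
Proof.
move=> iG infG; have [a Ga] := infinite_setN0 infG.
have [b [Gb /eqP ba]] := infinite_setN0 (infinite_setD infG (finite_set1 a)).
exists ((a + b) / 2).
by have [ab|ab|ab] := ltgtP a b; [
  apply: (between_interior iG Ga Gb); lra |
  apply: (between_interior iG Gb Ga); lra |
  move: ba; rewrite ab eqxx].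
Qed.

(** If y < x, a common interior point appears: u when y < u, v when v < x, and otherwise the
    midpoint of y and x. *)
Lemma interval_le_of_interior (Gamma1 Gamma2 : set R) (u v : R) :
  is_interval Gamma1 -> is_interval Gamma2 -> Gamma1° `&` Gamma2° = set0 ->
  Gamma1° u -> Gamma2° v -> u < v ->
  forall x y, Gamma1 x -> Gamma2 y -> x <= y.
Proof.
move=> i1 i2 d12 u1 v2 uv x y Gx Gy.
have no z : Gamma1° z -> Gamma2° z -> False.
  by move=> z1 z2; have : (Gamma1° `&` Gamma2°) z by []; rewrite d12.
have Gu := interior_subset u1; have Gv := interior_subset v2.
rewrite leNgt; apply/negP => yx.
have [yu|uy] := ltP y u; first exact: no u1 (between_interior i2 Gy Gv yu uv).
have [vx|xv] := ltP v x; first exact: no (between_interior i1 Gu Gx uv vx) v2.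
apply: (no ((y + x) / 2)).
- by apply: (between_interior i1 Gu Gx); lra.
- by apply: (between_interior i2 Gy Gv); lra.
Qed.

(** [c] is the supremum of the interval on the left, and [e] is 1 if that interval is [Gamma1] and
    -1 if it is [Gamma2]. *)
Lemma disjoint_intervals_separated (Gamma1 Gamma2 : set R) :
  is_interval Gamma1 -> is_interval Gamma2 ->
  infinite_set Gamma1 -> infinite_set Gamma2 -> Gamma1° `&` Gamma2° = set0 ->
  exists e c : R, [/\ e = 1 \/ e = -1, forall x, Gamma1 x -> e * (x - c) <= 0
    & Gamma2 `<=` ray e c].
Proof.
move=> i1 i2 inf1 inf2 d12.
have [u u1] := infinite_interval_interior i1 inf1.
have [v v2] := infinite_interval_interior i2 inf2.
have Gu := interior_subset u1; have Gv := interior_subset v2.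
have [uv|vu|uv] := ltgtP u v.
- have le := interval_le_of_interior i1 i2 d12 u1 v2 uv.
  exists 1, (sup Gamma1); split; first by left.
  + move=> x Gx; rewrite mul1r subr_le0; apply: ub_le_sup => //.
    by exists v => y /le; apply.
  + move=> y Gy; rewrite /ray/= mul1r subr_ge0; apply: ge_sup; first by exists u.
    by move=> x Gx; exact: le.
- have d21 : Gamma2° `&` Gamma1° = set0 by rewrite setIC.
  have le := interval_le_of_interior i2 i1 d21 v2 u1 vu.
  exists (-1), (sup Gamma2); split; first by right.
  + move=> x Gx; rewrite mulN1r oppr_le0 subr_ge0; apply: ge_sup; first by exists v.
    by move=> y Gy; exact: le.
  + move=> y Gy; rewrite /ray/= mulN1r oppr_ge0 subr_le0; apply: ub_le_sup => //.
    by exists u => x /le; apply.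
- exfalso; have : (Gamma1° `&` Gamma2°) u by split=> //; rewrite uv.
  by rewrite d12.
Qed.

End Separation.

(** * Integrals against mu1 and mu2 as integrals against sigma1 *)

Section MomentFormula.
Variable R : realType.
Variables (mu1 mu2 sigma1 sigma2 : cs_measure R) (e c : R).
Hypothesis e_sign : e = 1 \/ e = -1.
Let rho := cs_abs sigma1.
Let nu := cs_abs sigma2.
Let tau := cs_abs mu2.
Hypothesis nu_ray : nu (~` ray e c) = 0%E.
Hypothesis rho_ray : rho [set x | 0 < e * (x - c)] = 0%E.
Hypothesis rho_neq0 : rho setT != 0%E.
Hypothesis mu1E : forall B : set R, measurable (B : set (measurableTypeR R)) ->
  cs_eval mu1 B = cs_eval sigma1 B.
Hypothesis mu2E : forall B : set R, measurable (B : set (measurableTypeR R)) ->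
  cs_eval mu2 B = cs_eintegral sigma1 B (stieltjes sigma2).

(* The side of c carrying sigma1; c itself is included only if it is an atom,
   in which case m_{sigma2}(c) is finite. *)
Definition generator_domain : set R :=
  [set x | e * (x - c) < 0] `|` [set x | x = c /\ rho [set c] != 0%E].

Definition generator_transform (x : R) : R :=
  cs_sign sigma2 * cauchy_transform nu e c x.

Let D : set (measurableTypeR R) := generator_domain.
Let g := generator_transform.

Lemma open_generator_side : open [set x : R | e * (x - c) < 0].
Proof.
rewrite (_ : [set x : R | _] = (fun x => e * (x - c)) @^-1` [set x | x < 0])//.
apply: open_comp; last exact: open_lt.
move=> t _; apply: cvgM; first exact: cvg_cst.
by apply: cvgB; [exact: cvg_id|exact: cvg_cst].
Qed.

Let open_other_side : open [set x : R | 0 < e * (x - c)].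
Proof.
rewrite (_ : [set x : R | _] = (fun x => e * (x - c)) @^-1` [set x | 0 < x])//.
apply: open_comp; last exact: open_gt.
move=> t _; apply: cvgM; first exact: cvg_cst.
by apply: cvgB; [exact: cvg_id|exact: cvg_cst].
Qed.

Let atom_set : [set x | x = c /\ rho [set c] != 0%E] =
  if rho [set c] != 0%E then [set c] else set0.
Proof.
apply/seteqP; split => [x [-> ->//]|x].
by case: ifP => //= h ->.
Qed.

Lemma measurable_generator_domain : measurable D.
Proof.
apply: measurableU; first by apply: open_measurable; exact: open_generator_side.
by rewrite atom_set; case: ifP => _; [exact: measurable_set1|exact: measurable0].
Qed.

Lemma generator_domain_full : rho (~` D) = 0%E.
Proof.
have mD := measurable_generator_domain.
have mo : measurable ([set x | 0 < e * (x - c)] : set (measurableTypeR R)).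
  by apply: open_measurable; exact: open_other_side.
have mc : measurable ((if rho [set c] == 0%E then [set c] else set0) :
    set (measurableTypeR R)).
  by case: ifP => _; [exact: measurable_set1|exact: measurable0].
apply/eqP; rewrite -measure_le0.
apply: (@le_trans _ _ (rho ([set x | (0 < e * (x - c))%R] `|`
    if rho [set c] == 0%E then [set c] else set0))).
  apply: le_measure; rewrite ?inE.
  - exact: measurableC.
  - exact: measurableU.
  move=> x Dx /=; have [lt|gt|xc] := ltgtP (e * (x - c)) 0.
  - by exfalso; apply: Dx; left.
  - by left.
  right; have {}xc : x = c.
    apply/eqP; rewrite -subr_eq0; move/eqP: xc; rewrite mulf_eq0.
    by case: e_sign => ->; rewrite ?oppr_eq0 oner_eq0.
  rewrite xc in Dx *; case: ifPn => // n0; exfalso; apply: Dx; right; split => //.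
apply: (le_trans (measureU2 _ mo mc)).
move: rho_ray => /= ->; rewrite add0e.
by case: ifPn => [/eqP ->|_]; rewrite ?measure0.
Qed.

Let signM (s : cs_measure R) : cs_sign s * cs_sign s = 1.
Proof. by rewrite /cs_sign -expr2 sqrr_sign. Qed.

Let r := cs_sign mu2 * cs_sign sigma1.

Let r_sign : r * r = 1.
Proof. by rewrite /r mulrACA !signM mul1r. Qed.

Let tauE (B : set (measurableTypeR R)) : measurable B ->
  tau B = (r%:E * \int[rho]_(x in B) stieltjes sigma2 x)%E.
Proof.
move=> mB; have := mu2E mB; rewrite /cs_eval /cs_eintegral => h.
by rewrite /r EFinM -muleA -h muleA -EFinM signM mul1e.
Qed.

(** Up to sign, the finite mass of mu2 at [c] is m_{sigma2}(c) times the positive mass of sigma1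
    there. *)
Let atom_fin : rho [set c] != 0%E -> (stieltjes sigma2 c \is a fin_num)%E.
Proof.
move=> rc; have mc : measurable ([set c] : set (measurableTypeR R)).
  exact: measurable_set1.
have : (tau [set c] \is a fin_num)%E by exact: fin_num_measure.
rewrite (tauE mc).
rewrite (eq_integral (cst (stieltjes sigma2 c))); last first.
  by move=> x; rewrite inE => ->.
rewrite integral_cst//.
have rc0 : (0 < rho [set c])%E by rewrite lt0e rc measure_ge0.
have r0 : r != 0 by apply: contra_eq_neq r_sign => ->; rewrite mul0r eq_sym oner_eq0.
case: (stieltjes sigma2 c) => [//||].
- rewrite gt0_mulye//; move: r0; rewrite neq_lt => /orP[r0|r0].
    by rewrite lt0_muley.
  by rewrite gt0_muley.
- rewrite gt0_mulNye//; move: r0; rewrite neq_lt => /orP[r0|r0].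
    by rewrite lt0_muleNy.
  by rewrite gt0_muleNy.
Qed.

Lemma stieltjes_generator_domain (x : R) : D x ->
  stieltjes sigma2 x = (g x)%:E.
Proof.
move=> [xc|[-> /atom_fin fc]]; first exact: stieltjes_off_ray.
by have [] := stieltjes_fin_num nu_ray fc.
Qed.

Lemma generator_atom : rho [set c] != 0%E -> nu [set c] = 0%E /\
  nu.-integrable (ray e c) (EFin \o (fun t => (t - c)^-1)).
Proof. by move=> /atom_fin fc; have [] := stieltjes_fin_num nu_ray fc. Qed.

Lemma generator_transform_continuous (x : R) : e * (x - c) < 0 ->
  {for x, continuous g}.
Proof.
move=> xc; apply: cvgM; first exact: cvg_cst.
exact: cauchy_transform_continuous.
Qed.

Let mg : measurable_fun D g.
Proof.
apply/measurable_funU.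
- by apply: open_measurable; exact: open_generator_side.
- by rewrite atom_set; case: ifP => _; [exact: measurable_set1|exact: measurable0].
split.
  apply: open_continuous_measurable_fun; first exact: open_generator_side.
  by move=> x; rewrite inE => xc; exact: generator_transform_continuous.
rewrite atom_set; case: ifP => _; first exact: measurable_fun_set1.
exact: measurable_fun_set0.
Qed.

Lemma cs_integral_mu2 (p : R -> R) : tau.-integrable setT (EFin \o p) ->
  rho.-integrable D (EFin \o (fun x => p x * g x)) /\
  cs_integral mu2 p = cs_sign sigma1 * \int[rho]_(x in D) (p x * g x).
Proof.
move=> ip; have mD := measurable_generator_domain; have fD := generator_domain_full.
split; first exact: (density_integrable r_sign mD mg stieltjes_generator_domain tauE ip).
rewrite /cs_integral.
rewrite (density_Rintegral r_sign mD fD mg stieltjes_generator_domain tauE ip).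
by rewrite mulrA /r mulrA signM mul1r.
Qed.

Lemma cs_integral_mu1 (p : R -> R) : rho.-integrable setT (EFin \o p) ->
  rho.-integrable D (EFin \o p) /\
  cs_integral mu1 p = cs_sign sigma1 * \int[rho]_(x in D) p x.
Proof.
move=> ip; have mD := measurable_generator_domain; have fD := generator_domain_full.
split; first by apply: integrableS ip.
rewrite -(Rintegral_full_measure mD fD ip) /cs_integral.
have mu1r (B : set (measurableTypeR R)) : measurable B ->
    cs_abs mu1 B = ((cs_sign mu1 * cs_sign sigma1)%:E * rho B)%E.
  move=> mB; have := mu1E mB; rewrite /cs_eval => h.
  by rewrite EFinM -muleA -h muleA -EFinM signM mul1e.
(* Opposite signs would make the non-zero positive measure [rho] equal to the negative of a positive
   one. *)
have s11 : cs_sign mu1 * cs_sign sigma1 = 1.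
  rewrite /cs_sign -signr_addb; case: (boolP (_ (+) _)) => // odd.
  exfalso; move/negP: rho_neq0; apply; rewrite -measure_le0.
  have h : cs_abs mu1 setT = (- rho setT)%E.
    by rewrite mu1r// /cs_sign -signr_addb odd expr1 EFinN mulN1e.
  by rewrite -oppe_ge0 -h measure_ge0.
have -> : cs_sign mu1 = cs_sign sigma1.
  by rewrite -[LHS]mulr1 -(signM sigma1) mulrA s11 mul1r.
congr (_ * fine _); apply: eq_measure_integral => A mA _.
by have := mu1r _ mA; rewrite s11 mul1e.
Qed.

End MomentFormula.

(** * Signs of the weights at ordered nodes *)

Section NodeWeightSign.

(** Among the N - 1 factors e (x_i - x_j), exactly the [i] ones with j < i are negative. *)
Lemma node_weight_sign (R : realFieldType) (N : nat) (x : 'I_N -> R) (e : R) (i : 'I_N) :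
  e = 1 \/ e = -1 -> (forall i j : 'I_N, (i < j)%N -> e * (x j - x i) < 0) ->
  0 < e ^+ N.-1 * (-1) ^+ i * node_weight x i.
Proof.
move=> e_sign xe; have ee : e * e = 1 by case: e_sign => ->; rewrite ?mulr1 ?mulrNN ?mulr1.
have gt0 : 0 < \prod_(j | j != i) ((-1) ^+ (j < i)%N * (e * (x i - x j))).
  apply: prodr_gt0 => j; rewrite -val_eqE neq_ltn => /orP[ji|ij].
    have := xe _ _ ji; rewrite ji expr1; lra.
  have -> : (j < i)%N = false by apply/negbTE; rewrite -leqNgt ltnW.
  have := xe _ _ ij; rewrite expr0; lra.
have E : \prod_(j | j != i) ((-1) ^+ (j < i)%N * (e * (x i - x j))) =
    (-1) ^+ i * (e ^+ N.-1 * (node_weight x i)^-1).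
  rewrite !big_split /= invrK; congr (_ * (_ * _)).
    rewrite -expr_sum; congr (_ ^+ _).
    rewrite -[RHS]card_ord -sum1_card (big_ord_widen _ (fun=> 1%N) (ltnW (ltn_ord i))).
    rewrite big_mkcond [RHS]big_mkcond /=; apply: eq_bigr => j _.
    by rewrite -val_eqE; case: (ltngtP j i) => // ->; rewrite eqxx.
  rewrite prodr_const; congr (_ ^+ _).
  by rewrite cardC1 card_ord.
rewrite E in gt0; have w0 : node_weight x i != 0.
  by apply: contraTneq gt0 => ->; rewrite invr0 !mulr0 ltxx.
have w2 : 0 < node_weight x i ^+ 2 by rewrite exprn_even_gt0.
have := mulr_gt0 gt0 w2; congr (0 < _); field.
exact: w0.
Qed.

End NodeWeightSign.

(** * Integrals of finite sums and of polynomials *)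

Section RintegralSum.
Variable R : realType.
Variable mu : {finite_measure set (measurableTypeR R) -> \bar R}.
Variable D : set (measurableTypeR R).
Hypothesis mD : measurable D.

Lemma Rintegral_sum (I : Type) (s : seq I) (f : I -> R -> R) :
  (forall i, mu.-integrable D (EFin \o f i)) ->
  mu.-integrable D (EFin \o (fun x => \sum_(i <- s) f i x)) /\
  \int[mu]_(x in D) (\sum_(i <- s) f i x) = \sum_(i <- s) \int[mu]_(x in D) f i x.
Proof.
move=> fi; elim: s => [|a s [IH1 IH2]].
  rewrite (_ : (fun x => _) = (fun=> 0)); last by apply/funext => x; rewrite big_nil.
  by split; [exact: integrable0|rewrite Rintegral_cst// mul0r big_nil].
rewrite (_ : (fun x => _) = (fun x => f a x + \sum_(i <- s) f i x)); last first.
  by apply/funext => x; rewrite big_cons.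
split; last by rewrite RintegralD// IH2 big_cons.
have -> : EFin \o (fun x => f a x + \sum_(i <- s) f i x) =
  (EFin \o f a) \+ (EFin \o (fun x => \sum_(i <- s) f i x)) by [].
exact: integrableD.
Qed.

Lemma integrable_horner (p : {poly R}) :
  (forall k, mu.-integrable D (fun x : R => (x ^+ k)%:E)) ->
  mu.-integrable D (EFin \o (fun x => p.[x])).
Proof.
move=> xi; rewrite (_ : (fun x => p.[x]) = (fun x => \sum_(k < size p) p`_k * x ^+ k)).
  have [//|+ _] := Rintegral_sum (index_enum 'I_(size p))
    (f := fun k x => p`_k * x ^+ k); last by [].
  by move=> k; apply: (@integrableZl _ _ _ _ _ mD _ (fun x : R => (x ^+ k)%:E)).
by apply/funext => x; rewrite horner_coef.
Qed.

End RintegralSum.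

(** * Values of a Cauchy transform at nodes off the ray *)

Section CauchyNodes.
Variable R : realType.

Lemma finite_set_root (p : {poly R}) : p != 0 -> finite_set [set x | root p x].
Proof.
move=> p0; apply: contrapT => /(infinite_set_fset (size p))[B Bp sB].
have rB : all (root p) (finmap.enum_fset B) by apply/allP => x xB; exact: Bp.
have := max_poly_roots p0 rB (finmap.fset_uniq B).
by rewrite ltnNge sB.
Qed.

Variable nu : {finite_measure set (measurableTypeR R) -> \bar R}.
Variables (e c : R).
Hypothesis e_sign : e = 1 \/ e = -1.
Hypothesis nu_ray : nu (~` ray e c) = 0%E.
Hypothesis nu_inf : infinite_set (msupport nu).

Let ee : e * e = 1.
Proof. by case: e_sign => ->; rewrite ?mulr1// mulrNN mulr1. Qed.

Let mray : measurable (ray e c : set (measurableTypeR R)).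
Proof. exact: measurable_ray. Qed.

Let kernel_gt0 (x t : R) : e * (x - c) < 0 -> ray e c t -> 0 < e * (t - x).
Proof. by rewrite /ray /= => xc tc; lra. Qed.

Lemma cauchy_transform_sign (x : R) : e * (x - c) < 0 ->
  0 < e * cauchy_transform nu e c x.
Proof.
move=> xc; have ik := cauchy_kernel_integrable nu e_sign xc.
rewrite /cauchy_transform -RintegralZl//.
have pos t : ray e c t -> 0 < e * (t - x)^-1.
  move=> /(kernel_gt0 xc) h.
  have -> : e * (t - x)^-1 = (e * (t - x))^-1.
    have e0 : e != 0 by apply: contra_eq_neq ee => ->; rewrite mul0r eq_sym oner_eq0.
    by rewrite invfM; congr (_ * _); apply: (mulfI e0); rewrite ee mulfV.
  by rewrite invr_gt0.
have [x0 x0s] := infinite_setN0 nu_inf.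
apply: (Rintegral_gt0 mray nu_ray (x0 := x0)) => //.
- exact: (@integrableZl _ _ _ _ _ mray e _ ik).
- by move=> t /pos/ltW.
- by apply: (@filterS _ (nbhs x0) _ setT) => [t _|]; [exact: pos|exact: filterT].
Qed.

Variables (N : nat) (x : 'I_N -> R).
Hypothesis xc : forall i, e * (x i - c) < 0.
Hypothesis xe : forall i j : 'I_N, (i < j)%N -> e * (x j - x i) < 0.

Let x_inj : injective x.
Proof.
move=> i j xij; apply/val_inj; case: (ltngtP i j) => // /xe;
  by rewrite xij subrr mulr0 ltxx.
Qed.

Let ray_neq i t : ray e c t -> t != x i.
Proof.
by move=> /(kernel_gt0 (xc i)); apply: contraTneq => ->; rewrite subrr mulr0 ltxx.
Qed.

(** Partial fractions turn the sum into the integral of p(t) over the product of the e (t - x_i),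
    which are positive on the ray. Since the support is infinite, it has a point that is not a zero
    of [p]. *)
Lemma cauchy_transform_pos (p : {poly R}) : p != 0 -> (size p <= N)%N ->
  (forall t, 0 <= p.[t]) ->
  0 < e ^+ N * \sum_i p.[x i] * cauchy_transform nu e c (x i) * node_weight x i.
Proof.
move=> p0 sp pge0.
pose f i t := (e ^+ N * (p.[x i] * node_weight x i)) * (t - x i)^-1.
have fi i : nu.-integrable (ray e c) (EFin \o f i).
  have ik := cauchy_kernel_integrable nu e_sign (xc i).
  exact: (@integrableZl _ _ _ _ _ mray (e ^+ N * (p.[x i] * node_weight x i)) _ ik).
have [isum Isum] := Rintegral_sum mray (index_enum 'I_N) fi.
have -> : e ^+ N * \sum_i p.[x i] * cauchy_transform nu e c (x i) * node_weight x i =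
    \sum_i \int[nu]_(t in ray e c) f i t.
  rewrite mulr_sumr; apply: eq_bigr => i _.
  rewrite /f RintegralZl//; last exact: cauchy_kernel_integrable.
  by rewrite -/(cauchy_transform nu e c (x i)); ring.
rewrite -Isum.
have fE t : ray e c t -> \sum_i f i t = p.[t] * (\prod_i (e * (t - x i)))^-1.
  move=> rt; have := node_weight_partial_fractions x_inj sp (fun i => ray_neq i rt).
  rewrite big_split/= prodr_const card_ord.
  have -> : \sum_i f i t = e ^+ N * (\sum_i p.[x i] * node_weight x i / (t - x i)).
    by rewrite mulr_sumr; apply: eq_bigr => i _; rewrite /f -!mulrA.
  move=> <-; rewrite invfM.
  have eN : e ^+ N != 0.
    by rewrite expf_neq0//; apply: contra_eq_neq ee => ->; rewrite mul0r eq_sym oner_eq0.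
  have -> : (e ^+ N)^-1 = e ^+ N.
    by apply: (mulfI eN); rewrite mulfV// -exprMn ee expr1n.
  by rewrite mulrCA.
have prod_gt0 t : ray e c t -> 0 < (\prod_i (e * (t - x i)))^-1.
  by move=> rt; rewrite invr_gt0 prodr_gt0// => i _; exact: kernel_gt0.
have [x0 [x0s /negP px0]] := infinite_setN0 (infinite_setD nu_inf (finite_set_root p0)).
apply: (Rintegral_gt0 mray nu_ray (x0 := x0)) => //.
- by move=> t rt; rewrite fE// mulr_ge0// ltW// prod_gt0.
have : \forall t \near x0, 0 < p.[t].
  have : 0 < p.[x0] by rewrite lt_neqAle eq_sym px0/=.
  by move=> px; have /cvgr_gt := @continuous_horner R p x0; apply.
by apply: filterS => t pt rt; rewrite fE// mulr_gt0// prod_gt0.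
Qed.

Lemma cauchy_transform_nodes (s2 : R) : s2 * s2 = 1 ->
  stieltjes_nodes x (fun i => s2 * cauchy_transform nu e c (x i)) (s2 * e ^+ N).
Proof.
move=> s22; split => //.
- move=> p p0 sp pge0; have := cauchy_transform_pos p0 sp pge0.
  congr (0 < _); rewrite !mulr_sumr; apply: eq_bigr => i _.
  by ring: s22.
- move=> i; have h1 := node_weight_sign i e_sign xe.
  have h2 := cauchy_transform_sign (xc i).
  have := mulr_gt0 h1 h2; congr (0 < _).
  (* One factor [e] is the sign of the transform; the others belong to the weight. *)
  have -> : e ^+ N = e * e ^+ N.-1.
    by rewrite -exprS prednK// (leq_ltn_trans _ (ltn_ord i)).
  by ring: s22.
Qed.

End CauchyNodes.

(** * Zeros of the linear form attached to a type I vector *)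

Section NikishinNodes.
Variable R : realType.

Definition type_I_moment (mu1 mu2 : cs_measure R) (P : {poly R} * {poly R}) (k : nat) : R :=
  cs_integral mu1 (fun x => P.1.[x] * x ^+ k) +
  cs_integral mu2 (fun x => P.2.[x] * x ^+ k).

Variables (mu1 mu2 sigma1 sigma2 : cs_measure R) (e c : R).
Hypothesis e_sign : e = 1 \/ e = -1.
Let rho := cs_abs sigma1.
Let nu := cs_abs sigma2.
Let tau := cs_abs mu2.
Hypothesis nu_ray : nu (~` ray e c) = 0%E.
Hypothesis rho_ray : rho [set x | 0 < e * (x - c)] = 0%E.
Hypothesis rho_supp : forall x, msupport rho x -> e * (x - c) <= 0.
Hypotheses (rho_inf : infinite_set (msupport rho))
  (nu_inf : infinite_set (msupport nu)).
Hypothesis mu1E : forall B : set R, measurable (B : set (measurableTypeR R)) ->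
  cs_eval mu1 B = cs_eval sigma1 B.
Hypothesis mu2E : forall B : set R, measurable (B : set (measurableTypeR R)) ->
  cs_eval mu2 B = cs_eintegral sigma1 B (stieltjes sigma2).
Hypothesis rho_mom : forall k, rho.-integrable setT (fun x : R => (x ^+ k)%:E).
Hypothesis tau_mom : forall k, tau.-integrable setT (fun x : R => (x ^+ k)%:E).

Let D : set (measurableTypeR R) := generator_domain sigma1 e c.
Let g := generator_transform sigma2 e c.
Let J : set R := [set x | e * (x - c) < 0].

Let mD : measurable D.
Proof. exact: measurable_generator_domain. Qed.

Let fD : rho (~` D) = 0%E.
Proof. exact: generator_domain_full. Qed.

Let ee : e * e = 1.
Proof. by case: e_sign => ->; rewrite ?mulr1// mulrNN mulr1. Qed.

Let rho_neq0 : rho setT != 0%E.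
Proof.
have [x0 x0s] := infinite_setN0 rho_inf.
by apply: x0s => //; exact: openT.
Qed.

(** The linear form P1 + P2 m_{sigma2}, whose moments against sigma1 are the type I moments. *)
Definition type_I_function (P : {poly R} * {poly R}) (x : R) : R :=
  P.1.[x] + P.2.[x] * g x.

Let int_p1 (p : {poly R}) k : rho.-integrable setT (EFin \o (fun x => p.[x] * x ^+ k)).
Proof.
have -> : (fun x => p.[x] * x ^+ k) = (fun x => (p * 'X^k).[x]).
  by apply/funext => x; rewrite hornerM hornerXn.
exact: integrable_horner.
Qed.

Let int_p2 (p : {poly R}) k : tau.-integrable setT (EFin \o (fun x => p.[x] * x ^+ k)).
Proof.
have -> : (fun x => p.[x] * x ^+ k) = (fun x => (p * 'X^k).[x]).
  by apply/funext => x; rewrite hornerM hornerXn.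
exact: integrable_horner.
Qed.

Lemma type_I_momentE P k :
  rho.-integrable D (EFin \o (fun x => x ^+ k * type_I_function P x)) /\
  type_I_moment mu1 mu2 P k =
    cs_sign sigma1 * \int[rho]_(x in D) (x ^+ k * type_I_function P x).
Proof.
have [i1 e1] := cs_integral_mu1 e_sign rho_ray rho_neq0 mu1E (int_p1 P.1 k).
have [i2 e2] := cs_integral_mu2 e_sign nu_ray rho_ray mu2E (int_p2 P.2 k).
have -> : (fun x => x ^+ k * type_I_function P x) =
    (fun x => P.1.[x] * x ^+ k + P.2.[x] * x ^+ k * g x).
  by apply/funext => x; rewrite /type_I_function; ring.
split.
  rewrite (_ : EFin \o _ = (EFin \o (fun x => P.1.[x] * x ^+ k)) \+
    (EFin \o (fun x => P.2.[x] * x ^+ k * g x)))//.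
  exact: integrableD.
by rewrite RintegralD// /type_I_moment mulrDr e1 e2.
Qed.

Lemma type_I_moment_comb a b P Q k :
  type_I_moment mu1 mu2 (a *: P.1 + b *: Q.1, a *: P.2 + b *: Q.2) k =
  a * type_I_moment mu1 mu2 P k + b * type_I_moment mu1 mu2 Q k.
Proof.
have [iP eP] := type_I_momentE P k; have [iQ eQ] := type_I_momentE Q k.
rewrite (type_I_momentE _ k).2 eP eQ.
have -> : (fun x => x ^+ k *
      type_I_function (a *: P.1 + b *: Q.1, a *: P.2 + b *: Q.2) x) =
    (fun x => a * (x ^+ k * type_I_function P x) + b * (x ^+ k * type_I_function Q x)).
  by apply/funext => x; rewrite /type_I_function /= !hornerD !hornerZ; ring.
rewrite RintegralD//.
- by rewrite !RintegralZl//; ring.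
- exact: (@integrableZl _ _ _ _ _ mD a _ iP).
- exact: (@integrableZl _ _ _ _ _ mD b _ iQ).
Qed.

Section Zeros.
Variables (N : nat) (P : {poly R} * {poly R}).
Hypothesis orth : forall k, (k < N)%N -> type_I_moment mu1 mu2 P k = 0.
Let F := type_I_function P.

Lemma type_I_function_orthogonal (q : {poly R}) : (size q <= N)%N ->
  rho.-integrable D (EFin \o (fun x => q.[x] * F x)) /\
  \int[rho]_(x in D) (q.[x] * F x) = 0.
Proof.
move=> sq; pose f (k : 'I_N) x := q`_k * (x ^+ k * F x).
have xi k := (type_I_momentE P k).1.
have fi k : rho.-integrable D (EFin \o f k).
  exact: (@integrableZl _ _ _ _ _ mD q`_k _ (xi k)).
have E : (fun x => q.[x] * F x) = (fun x => \sum_k f k x).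
  apply/funext => x; rewrite (horner_coef_wide _ sq) mulr_suml.
  by apply: eq_bigr => k _; rewrite /f mulrA.
have [h1 h2] := Rintegral_sum mD (index_enum 'I_N) fi.
rewrite E; split; first exact: h1.
rewrite h2 big1// => k _; rewrite /f RintegralZl//; last exact: xi.
have := orth (ltn_ord k); rewrite (type_I_momentE P k).2 => /eqP.
by rewrite mulf_eq0 /cs_sign signr_eq0/= => /eqP ->; rewrite mulr0.
Qed.

Let cF x : J x -> {for x, continuous F}.
Proof.
move=> Jx; apply: cvgD; first exact: continuous_horner.
apply: cvgM; first exact: continuous_horner.
exact: generator_transform_continuous.
Qed.

(* At an atom c of sigma1 the sign is inherited from the side J by letting x
   tend to c. *)
Let sign_extends (q : {poly R}) : (forall x, J x -> 0 <= q.[x] * F x) ->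
  forall x, D x -> 0 <= q.[x] * F x.
Proof.
move=> qF x [/qF//|[-> rc]].
have [nuc ic] := generator_atom nu_ray mu2E rc.
pose y (n : nat) := c - e * n.+1%:R^-1.
have yc : y @ \oo --> c.
  rewrite /y -[X in _ --> X]subr0 -(mulr0 e); apply: cvgB; first exact: cvg_cst.
  by apply: cvgM; [exact: cvg_cst|exact: cvg_harmonic].
have cp (p : {poly R}) : (fun n => p.[y n]) @ \oo --> p.[c].
  exact: (cvg_comp _ _ yc (@continuous_horner R p c)).
have lim : (fun n => q.[y n] * F (y n)) @ \oo --> q.[c] * F c.
  apply: cvgM; first exact: cp.
  apply: cvgD; first exact: cp.
  apply: cvgM; first exact: cp.
  apply: cvgM; first exact: cvg_cst.
  exact: cauchy_transform_endpoint.
apply: (closed_cvg _ (@closed_ge R 0) _ _ lim).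
apply: (@filterS _ _ _ setT) => [n _|]; last exact: filterT.
apply: qF; rewrite /J /= /y addrAC subrr sub0r mulrN mulrA ee mul1r oppr_lt0.
by rewrite invr_gt0.
Qed.

(** By orthogonality [q * F] has integral zero; being nonnegative, it vanishes on the support of
    sigma1 off [c]. Discarding the zeros of [q] still leaves infinitely many points, at which [F]
    must vanish. *)
Let zeros_of_poly (q : {poly R}) : q != 0 -> (size q <= N)%N ->
  (forall x, J x -> 0 <= q.[x] * F x) -> infinite_set [set x | J x /\ F x = 0].
Proof.
move=> q0 sq qF.
apply: (@sub_infinite_set _ (msupport rho `\` ([set c] `|` [set x | root q x]))).
  move=> x [xs /not_orP[xc xq]].
  have Jx : J x.
    rewrite /J/= lt_neqAle rho_supp// andbT mulf_eq0 subr_eq0 negb_or.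
    apply/andP; split; last exact/eqP.
    by case: e_sign => ->; rewrite ?oppr_eq0 oner_eq0.
  split => //; apply: contrapT => /eqP Fx.
  have [iq Iq] := type_I_function_orthogonal sq.
  have qFx : 0 < q.[x] * F x.
    by rewrite lt_neqAle qF// andbT eq_sym mulf_neq0//; apply/negP.
  suff : 0 < \int[rho]_(x in D) (q.[x] * F x) by rewrite Iq ltxx.
  apply: (Rintegral_gt0 mD fD (x0 := x)) => //; first exact: sign_extends.
  have cqF : (fun z => q.[z] * F z) z @[z --> x] --> q.[x] * F x.
    by apply: cvgM; [exact: continuous_horner|exact: cF].
  have /cvgr_gt := cqF => /(_ _ qFx); apply: filterS => z + _; exact.
apply: infinite_setD => //; rewrite finite_setU; split; first exact: finite_set1.
exact: finite_set_root.
Qed.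

(** [P] may be zero, so the absence of enough sign changes is no contradiction: it yields infinitely
    many zeros, from which [N] are picked. *)
Lemma type_I_function_zeros : exists x : nat -> R,
  (forall i, (i < N)%N -> J (x i) /\ F (x i) = 0) /\
  (forall i j, (i < j)%N -> (j < N)%N -> x i < x j).
Proof.
have itvJ : is_interval J.
  move=> a b; rewrite /J/= => Ja Jb z /andP[az zb].
  by case: e_sign Ja Jb => ->; lra.
have cJ : {in J, continuous F} by move=> z; rewrite inE; exact: cF.
have [//|[q [q0 sq qF]]] := zeros_or_poly N itvJ cJ.
have [B BZ sB] := infinite_set_fset N (zeros_of_poly q0 sq qF).
pose s := sort <=%R (finmap.enum_fset B).
have ss : size s = size (finmap.enum_fset B) by rewrite size_sort.
exists (nth 0 s); split.
  move=> i iN; apply: BZ => /=.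
  have : nth 0 s i \in s by rewrite mem_nth// ss (leq_trans iN).
  by rewrite mem_sort.
move=> i j ij jN; have js : (j < size s)%N by rewrite ss (leq_trans jN).
apply: (sorted_ltn_nth lt_trans) => //.
- by rewrite lt_sorted_uniq_le sort_uniq finmap.fset_uniq sort_le_sorted.
- by rewrite inE (ltn_trans ij).
Qed.

Lemma type_I_function_nodes : interpolated_at_nodes N P.
Proof.
have [y [yJ yy]] := type_I_function_zeros.
have s22 : cs_sign sigma2 * cs_sign sigma2 = 1.
  by rewrite /cs_sign -expr2 sqrr_sign.
have [x [xJ xF xe]] : exists x : 'I_N -> R, [/\ forall i, J (x i),
    forall i, F (x i) = 0 & forall i j : 'I_N, (i < j)%N -> e * (x j - x i) < 0].
  (* The zeros are found in increasing order; for [e = 1] they are listed backwards, so that [e]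
     times the node always decreases with the index. *)
  case: (e_sign) => eE.
    exists (fun i => y (N - i.+1)%N).
    have lt (i : 'I_N) : (N - i.+1 < N)%N by rewrite ltn_subrL (leq_ltn_trans _ (ltn_ord i)).
    split => [i|i|i j ij]; [exact: (yJ _ (lt i)).1|exact: (yJ _ (lt i)).2|].
    rewrite eE mul1r subr_lt0; apply: yy => //.
    by have := ltn_ord j; have := ltn_ord i; lia.
  exists (fun i => y i); split => [i|i|i j ij].
  - exact: (yJ _ (ltn_ord i)).1.
  - exact: (yJ _ (ltn_ord i)).2.
  - by rewrite eE mulN1r oppr_lt0 subr_gt0; exact: yy.
exists x, (fun i => g (x i)), (cs_sign sigma2 * e ^+ N); split => //.
exact: cauchy_transform_nodes.
Qed.

End Zeros.
End NikishinNodes.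

(** * From a Nikishin system to the abstract moment functional *)

Section NikishinMoments.
Variable R : realType.

(** Infinite supports force both intervals to be infinite, so a point [c] separates them, and each
    measure is null on the open set beyond its own side. *)
Lemma nikishin_system_moments (mu1 mu2 sigma1 sigma2 : cs_measure R) :
  nikishin_system mu1 mu2 sigma1 sigma2 ->
  (forall a b P Q k,
    type_I_moment mu1 mu2 (a *: P.1 + b *: Q.1, a *: P.2 + b *: Q.2) k =
    a * type_I_moment mu1 mu2 P k + b * type_I_moment mu1 mu2 Q k) /\
  (forall N P, (forall k, (k < N)%N -> type_I_moment mu1 mu2 P k = 0) ->
    interpolated_at_nodes N P).
Proof.
move=> [_ [tau_mom _ _]] [Gamma1 [Gamma2 [[[i1 _] [i2 _]] d12]]].
move=> [[rho_mom rho_inf rhoG] [_ nu_inf nuG]] mu1E mu2E.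
have [e [c [e_sign G1 G2]]] := disjoint_intervals_separated i1 i2
  (sub_infinite_set rhoG rho_inf) (sub_infinite_set nuG nu_inf) d12.
have rho_supp x : msupport (cs_abs sigma1) x -> e * (x - c) <= 0.
  by move=> /rhoG/G1.
have rho_ray : cs_abs sigma1 [set x | 0 < e * (x - c)] = 0%E.
  apply: open_disjoint_support_null.
    rewrite (_ : [set x : R | _] = [set x | (- e) * (x - c) < 0]).
      exact: open_generator_side.
    by apply/seteqP; split => x /=; rewrite mulNr oppr_lt0.
  apply/seteqP; split => // x /= [ex /rho_supp].
  by rewrite leNgt ex.
have nu_ray : cs_abs sigma2 (~` ray e c) = 0%E.
  apply: open_disjoint_support_null.
    by apply: closed_openC; exact: closed_ray.
  by apply/seteqP; split => // x /= [nr /nuG/G2].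
split.
  exact: (type_I_moment_comb e_sign nu_ray rho_ray rho_inf mu1E mu2E rho_mom tau_mom).
exact: (type_I_function_nodes e_sign nu_ray rho_ray rho_supp rho_inf nu_inf
  mu1E mu2E rho_mom tau_mom).
Qed.

Lemma type_I_type_I_mom (mu1 mu2 : cs_measure R) n1 n2 P :
  type_I mu1 mu2 n1 n2 P -> type_I_mom (type_I_moment mu1 mu2) n1 n2 P.
Proof.
move=> [P0 [s1 s2] m0 m1]; split => //.
  by split => // k kN; apply: m0; lia.
by move=> N0; apply: m1; lia.
Qed.

End NikishinMoments.

End Nikishin.

(* The hypotheses 0 < n1 and 0 < n2 say that n - e_1 and n - e_2 are
   multi-indices.  When n1 = 1 (resp. n2 = 1) the polynomial A^(1)_{n - e_1}
   (resp. A^(2)_{n - e_2}) has degree at most -1, that is, it is zero, and there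
   is nothing to interlace with it. *)
Theorem theorem5p8 (R : realType) (mu1 mu2 sigma1 sigma2 : cs_measure R)
    (hN : nikishin_system mu1 mu2 sigma1 sigma2)
    (n1 n2 : nat) (hn1 : (0 < n1)%N) (hn2 : (0 < n2)%N)
    (A Ae1 Ae2 : {poly R} * {poly R})
    (hA : type_I mu1 mu2 n1 n2 A)
    (hAe1 : type_I mu1 mu2 (n1 - 1) n2 Ae1)
    (hAe2 : type_I mu1 mu2 n1 (n2 - 1) Ae2) :
  ((n1 + 1 <= n2)%N ->
     interlacing A.1 Ae2.1 /\
     ((1 < n1)%N -> interlacing A.1 Ae1.1 /\ interlacing Ae1.1 Ae2.1)) /\
  ((n2 <= n1 + 1)%N ->
     interlacing A.2 Ae1.2 /\
     ((1 < n2)%N -> interlacing A.2 Ae2.2 /\ interlacing Ae1.2 Ae2.2)).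
Proof.
have [mom_comb mom_nodes] := nikishin_system_moments hN.
have tA := type_I_type_I_mom hA.
have tAe1 := type_I_type_I_mom hAe1.
have tAe2 := type_I_type_I_mom hAe2.
split.
- exact: (type_I_mom_interlacing_l mom_comb mom_nodes hn1 hn2 tA tAe1 tAe2).
- exact: (type_I_mom_interlacing_r mom_comb mom_nodes hn1 hn2 tA tAe1 tAe2).
Qed.
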